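(* Let $\eta\in(0,1/2)$ and let $\lambda,\mu>0$ satisfy $\min(\lambda,\mu)\ge\frac{16}{\eta}$. Let $q>1$, let $c_\omega:\mathbb{R}^2\to[-\frac12,\frac12]$ be the random weight function with parameters $\lambda,\mu$ constructed in the context, and define, for $p=(p_1,p_2)\in\mathbb{R}^2$ and $x\in\mathbb{R}^2$, $$H(p,x,\omega)=-c_\omega(x)+|p_2|-|p_1|+\max\big(\|p\|_\infty-2,0\big)^q .$$ For $\varepsilon>0$ let $u^\varepsilon$ be the viscosity solution of $$\begin{cases}\partial_t u(t,x,\omega)+H\big(\nabla u(t,x,\omega),\tfrac{x}{\varepsilon},\omega\big)-\varepsilon\Delta u(t,x,\omega)=0 & \text{in }(0,\infty)\times\mathbb{R}^2,\\ u(0,x,\omega)=0 & \text{in }\mathbb{R}^2.\end{cases}$$ Then, almost surely, $$\liminf_{\varepsilon\to0}u^\varepsilon(1,0,\omega)\le-\frac12+\eta\qquad\text{and}\qquad\limsup_{\varepsilon\to0}u^\varepsilon(1,0,\omega)\ge\frac12-\eta .$$ Consequently, there is no stochastic homogenization for this Hamilton-Jacobi equation: there is no continuous $\bar H:\mathbb{R}^2\to\mathbb{R}$ such that almost surely $u^\varepsilon$ converges locally uniformly in $(t,x)$, as $\varepsilon\to 0$, to the viscosity solution of $\partial_t u+\bar H(\nabla u)=0$, $u(0,\cdot)=0$.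
   Context: Here $\|p\|_\infty=\max(|p_1|,|p_2|)$, and $u^\varepsilon(\cdot,\cdot,\omega)$ is the unique viscosity solution that is bounded on $[0,T]\times\mathbb{R}^2$ for every $T>0$. Construction of $c_\omega$. Let $T_k=2^k$ for $k\ge1$. Let $(X^j_{k,l,m})$, indexed by $j\in\{1,2\}$, $k\in\{1,2,\dots\}$, $(l,m)\in\mathbb{Z}^2$, be independent random variables on a probability space $(\Omega,\mathcal{F},\mathbb{P})$, with $X^j_{k,l,m}$ Bernoulli of parameter $T_k^{-2}$. Fix $\lambda,\mu>0$. Phase 1 (function $c^1_\omega$). Start with $c^1_\omega=0$ everywhere. For $k=1,2,\dots$ successively: for each $(l,m)\in\mathbb{Z}^2$ with $X^1_{k,l,m}=1$, consider the rectangle centered at $(l,m)$ whose horizontal side has length $\lambda T_k+1$ and whose vertical side has length $\mu+1$ (called a horizontal rectangle of length $\lambda T_k+1$), and set $c^1_\omega(x)=-\frac12$ for every $x$ in it. Phase 2 (function $c^2_\omega$). Start with $c^2_\omega=c^1_\omega$. For $k=1,2,\dots$ successively: for each $(l,m)\in\mathbb{Z}^2$ with $X^2_{k,l,m}=1$, consider the rectangle centered at $(l,m)$ whose vertical side has length $\lambda T_k+1$ and whose horizontal side has length $\mu+1$ (called a vertical rectangle of length $\lambda T_k+1$). For each $x$ in it: if $x$ lies in a horizontal rectangle of length $\lambda T_{k'}+1$ for some $k'>k$, then $c^2_\omega(x)$ is not modified; otherwise, if $x$ lies in a horizontal rectangle of length $\lambda T_k+1$, set $c^2_\omega(x)=0$;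 otherwise set $c^2_\omega(x)=\frac12$. (Almost surely every point lies in only finitely many rectangles, so $c^2_\omega$ is almost surely well defined; it takes values in $\{-\frac12,0,\frac12\}$.) Phase 3 (Lipschitz regularization). Define $$c_\omega(x)=\begin{cases}\max\Big(\inf_{y\in\mathbb{R}^2}\{c^2_\omega(y)+|x-y|\},\,0\Big) & \text{if }c^2_\omega(x)\ge0,\\ \min\Big(\sup_{y\in\mathbb{R}^2}\{c^2_\omega(y)-|x-y|\},\,0\Big) & \text{if }c^2_\omega(x)\le0,\end{cases}$$ the two expressions both being $0$ when $c^2_\omega(x)=0$. *)

(* Defs.v *)
(* MathComp-Analysis *)
From HB Require Import structures.
From mathcomp Require Import all_boot all_order all_algebra.
From mathcomp Require Import all_classical all_reals all_analysis.

Set Implicit Arguments.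
Unset Strict Implicit.
Unset Printing Implicit Defensive.

Import Order.TTheory GRing.Theory Num.Theory.
Import numFieldNormedType.Exports.

Local Open Scope classical_set_scope.
Local Open Scope ring_scope.

Section independence.
Context d d' (Omega : measurableType d) (T : measurableType d') (R : realType).
Variable P : probability Omega R.

Definition mutually_independent (I : eqType) (D : set I)
    (X : I -> {RV P >-> T}) : Prop :=
  forall (J : seq I) (A : I -> set T),
    uniq J -> [set` J] `<=` D -> (forall i, measurable (A i)) ->
    P (\bigcap_(i in [set` J]) (X i @^-1` A i)) =
    (\prod_(i <- J) P (X i @^-1` A i))%E.

End independence.

Section bernoulli_family.
Context d (Omega : measurableType d) (R : realType).
Variable P : probability Omega R.

Definition scale (k : nat) : R := 2 ^+ k.

(* Only the variables [X j k l m] with [j] in {1, 2} and [k >= 1] matter; those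
   with other indices are arbitrary and never used. *)
Definition bernoulli_field (X : nat -> nat -> int -> int -> {RV P >-> bool}) :
    Prop :=
  mutually_independent
    [set i : nat * nat * int * int | (1 <= i.1.1.1 <= 2)%N /\ (1 <= i.1.1.2)%N]
    (fun i => X i.1.1.1 i.1.1.2 i.1.2 i.2) /\
  (forall j k l m, (1 <= j <= 2)%N -> (1 <= k)%N ->
     distribution P (X j k l m) =1 bernoulli_prob (scale k ^- 2)).

End bernoulli_family.

Section weight.
Context (R : realType).
Variables (lambda mu : R).
(* a realization of the Bernoulli variables *)
Variable xi : nat -> nat -> int -> int -> bool.

Definition in_rectangle (a b : R) (l m : int) (x : R * R) : Prop :=
  `|x.1 - l%:~R| <= a / 2 /\ `|x.2 - m%:~R| <= b / 2.

Definition in_horizontal (k : nat) (x : R * R) : Prop :=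
  exists l m : int,
    xi 1%N k l m /\ in_rectangle (lambda * scale R k + 1) (mu + 1) l m x.

Definition in_vertical (k : nat) (x : R * R) : Prop :=
  exists l m : int,
    xi 2%N k l m /\ in_rectangle (mu + 1) (lambda * scale R k + 1) l m x.

(* [c1_stage n] and [c2_stage n] are the functions obtained once the steps
   k = 1, ..., n of the phase have been carried out. *)
Fixpoint c1_stage (n : nat) (x : R * R) : R :=
  match n with
  | 0 => 0
  | k.+1 => if `[< in_horizontal k.+1 x >] then - 2^-1 else c1_stage k x
  end.

Definition c1 (x : R * R) : R := limn (c1_stage ^~ x).

Fixpoint c2_stage (n : nat) (x : R * R) : R :=
  match n with
  | 0 => c1 x
  | k.+1 =>
    if `[< in_vertical k.+1 x >] then
      if `[< exists k', (k.+1 < k')%N /\ in_horizontal k' x >] then c2_stage k x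
      else if `[< in_horizontal k.+1 x >] then 0 else 2^-1
    else c2_stage k x
  end.

(* For almost every realization the sequence is eventually constant at every
   point; otherwise the limit is a junk value. *)
Definition c2 (x : R * R) : R := limn (c2_stage ^~ x).

(* The norm of the product type [R * R] is the max norm. *)
Definition euclid (x : R * R) : R := Num.sqrt (x.1 ^+ 2 + x.2 ^+ 2).

(* In the second branch c2 x < 0; when c2 x = 0 both expressions vanish. *)
Definition weight (x : R * R) : R :=
  if 0 <= c2 x
  then Num.max (inf [set c2 y + euclid (x - y) | y in [set: R * R]]) 0
  else Num.min (sup [set c2 y - euclid (x - y) | y in [set: R * R]]) 0.

End weight.

Section viscosity.
Context (R : realType).

(* time-space points (t, (x1, x2)) *)
Local Notation pt := (R * (R * R))%type.

Definition e_t : pt := (1, (0, 0)).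
Definition e_1 : pt := (0, (1, 0)).
Definition e_2 : pt := (0, (0, 1)).

Definition dt (phi : pt -> R) (z : pt) : R := 'D_e_t phi z.

Definition grad (phi : pt -> R) (z : pt) : R * R :=
  ('D_e_1 phi z, 'D_e_2 phi z).

Definition laplacian (phi : pt -> R) (z : pt) : R :=
  'D_e_1 ('D_e_1 phi) z + 'D_e_2 ('D_e_2 phi) z.

(* class C^{1,2}: once in time, twice in space, on (0, oo) x R^2 *)
Definition C12 (phi : pt -> R) : Prop :=
  forall z : pt, 0 < z.1 ->
  [/\ {for z, continuous phi},
      derivable phi z e_t /\ {for z, continuous ('D_e_t phi)} &
      forall v, v = e_1 \/ v = e_2 ->
      [/\ derivable phi z v, {for z, continuous ('D_v phi)} &
          forall w, w = e_1 \/ w = e_2 ->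
            derivable ('D_v phi) z w /\ {for z, continuous ('D_w ('D_v phi))}]].

(* The equation is d_t u + H(grad u, x) - nu * Laplacian u = 0
   on (0, oo) x R^2; values of [u] at negative times are irrelevant. *)
Variables (nu : R) (H : R * R -> R * R -> R).

Definition residual (phi : pt -> R) (z : pt) : R :=
  dt phi z + H (grad phi z) z.2 - nu * laplacian phi z.

Definition viscosity_subsolution (u : pt -> R) : Prop :=
  forall (phi : pt -> R) (z : pt), C12 phi -> 0 < z.1 ->
    (\forall y \near z, u y - phi y <= u z - phi z) -> residual phi z <= 0.

Definition viscosity_supersolution (u : pt -> R) : Prop :=
  forall (phi : pt -> R) (z : pt), C12 phi -> 0 < z.1 ->
    (\forall y \near z, u z - phi z <= u y - phi y) -> 0 <= residual phi z.

(* The viscosity solution with zero initial datum, in the uniqueness class of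
   functions bounded on [0, T] x R^2 for all T > 0. *)
Definition viscosity_solution (u : pt -> R) : Prop :=
  [/\ {within [set z : pt | 0 <= z.1], continuous u},
      viscosity_subsolution u,
      viscosity_supersolution u,
      forall x, u (0, x) = 0 &
      forall T : R, 0 < T ->
        exists M : R, forall (t : R) x, 0 <= t <= T -> `|u (t, x)| <= M].

End viscosity.

Definition hamiltonian (R : realType) (q : R) (c : R * R -> R) (p x : R * R) : R :=
  - c x + `|p.2| - `|p.1|
  + Num.max (Num.max `|p.1| `|p.2| - 2) 0 `^ q.

Definition locally_uniform_cvg (R : realType) (u : R -> R * (R * R) -> R)
    (ubar : R * (R * R) -> R) : Prop :=
  forall K : set (R * (R * R)), compact K -> K `<=` [set z | 0 <= z.1] ->
    {uniform K, u eps @[eps --> 0^'+] --> ubar}.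

(* Main.v *)
Require Import Defs.
From HB Require Import structures.
From mathcomp Require Import all_boot all_order all_algebra.
From mathcomp Require Import all_classical all_reals all_analysis.
From mathcomp Require Import ring lra zify.

Import Order.TTheory GRing.Theory Num.Theory.
Import numFieldNormedType.Exports.

Local Open Scope classical_set_scope.
Local Open Scope ring_scope.

Set Implicit Arguments.
Unset Strict Implicit.

(** Take [eps = 2^-k], so that one microscopic length [T_k] is one macroscopic unit.
With probability bounded below, a horizontal rectangle of level [k] is centred within
[eta T_k] of the origin and no vertical rectangle of level at least [k] comes within a
few [T_k]; then [c = -1/2] on a tube of length of order [T_k] and fixed width.  The
player who minimizes along [x_2] reaches this tube at negligible cost and, as the
tube is wide compared with [1/eta], stays in it in spite of the diffusion, while the
other player cannot leave it through its ends before time 1.  This is made quantitative by an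
explicit smooth strict supersolution with gradient at most 2, so that the superlinear
term of the Hamiltonian never acts; being smooth and coercive, it is itself a legitimate
test function at a maximum of [u - w], and no doubling of variables is needed.
Exchanging the axes and signs gives the lower bound.  Such scales [k] occur infinitely
often almost surely: restricting the obstacles to the levels [k, 2k] gives independent
events along [k, 2k+1, 4k+3, ...], and the discarded levels have summably small
probability. *)

(** * Smooth test functions *)

(** The derivatives are carried as explicit functions in every direction, so that sums and the
    exchange of axes act on them by formula and the residual can be read off. *)
Definition jet {R : realType} (phi : R * (R * R) -> R)
    (D : R * (R * R) -> R * (R * R) -> R)
    (D2 : R * (R * R) -> R * (R * R) -> R * (R * R) -> R) : Prop :=
  [/\ continuous phi,
      forall v z, is_derive z v phi (D v z),
      forall v, continuous (D v),
      forall v w z, is_derive z w (D v) (D2 v w z) &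
      forall v w, continuous (D2 v w)].

Lemma jet_C12 (R : realType) (phi : R * (R * R) -> R) D D2 :
  jet phi D D2 -> C12 phi.
Proof.
move=> [c0 d1 c1 d2 c2] z _.
have E1 v : 'D_v phi = D v by apply/funext => y; exact: derive_val.
have E2 v w : 'D_w (D v) = D2 v w by apply/funext => y; exact: derive_val.
split; [exact: c0 | by rewrite E1; split; [exact: ex_derive | exact: c1] |].
move=> v _; rewrite E1; split; [exact: ex_derive | exact: c1 |].
by move=> w _; rewrite E2; split; [exact: ex_derive | exact: c2].
Qed.

Lemma residual_jet (R : realType) nu (H : R * R -> R * R -> R)
    (phi : R * (R * R) -> R) D D2 z :
  jet phi D D2 ->
  residual nu H phi z = D (e_t R) z + H (D (e_1 R) z, D (e_2 R) z) z.2
    - nu * (D2 (e_1 R) (e_1 R) z + D2 (e_2 R) (e_2 R) z).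
Proof.
move=> [c0 d1 c1 d2 c2].
have E1 v : 'D_v phi = D v by apply/funext => y; exact: derive_val.
have E2 v w : 'D_w (D v) = D2 v w by apply/funext => y; exact: derive_val.
have L v : 'D_v ('D_v phi) z = D2 v v z.
  exact: etrans (congr1 (fun f => 'D_v f z) (E1 v)) (congr1 (@^~ z) (E2 v v)).
have F v : 'D_v phi z = D v z := congr1 (@^~ z) (E1 v).
have K (a a' b b' c c' l l' k k' : R) : a = a' -> b = b' -> c = c' ->
    l = l' -> k = k' ->
    a + H (b, c) z.2 - nu * (l + k) = a' + H (b', c') z.2 - nu * (l' + k').
  by move=> -> -> -> -> ->.
exact: K (F (e_t R)) (F (e_1 R)) (F (e_2 R)) (L (e_1 R)) (L (e_2 R)).
Qed.

Lemma jetD (R : realType) (f g : R * (R * R) -> R) Df Df2 Dg Dg2 :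
  jet f Df Df2 -> jet g Dg Dg2 ->
  jet (fun z => f z + g z) (fun v z => Df v z + Dg v z)
    (fun v w z => Df2 v w z + Dg2 v w z).
Proof.
move=> [f0 f1 f2 f3 f4] [g0 g1 g2 g3 g4]; split.
- by move=> z; apply: cvgD; [exact: f0 | exact: g0].
- by move=> v z; apply: is_deriveD.
- by move=> v z; apply: cvgD; [exact: f2 | exact: g2].
- by move=> v w z; apply: is_deriveD.
- by move=> v w z; apply: cvgD; [exact: f4 | exact: g4].
Qed.

(** The map [u |-> - u \o swapx] leaves [|p_2| - |p_1|] in place and replaces the weight by its
    opposite; it carries the upper bound to the lower one. *)
Definition swapx {R : realType} (z : R * (R * R)) : R * (R * R) :=
  (z.1, (z.2.2, z.2.1)).

Lemma snd_fst_cts (R : realType) : continuous (fun z : R * (R * R) => z.2.1).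
Proof.
move=> z; apply: (@continuous_comp _ _ _ (@snd R (R * R)) (@fst R R)).
  exact: cvg_snd.
exact: cvg_fst.
Qed.

Lemma snd_snd_cts (R : realType) : continuous (fun z : R * (R * R) => z.2.2).
Proof.
move=> z; apply: (@continuous_comp _ _ _ (@snd R (R * R)) (@snd R R)).
  exact: cvg_snd.
exact: cvg_snd.
Qed.

Lemma swapx_cts (R : realType) : continuous (@swapx R).
Proof.
move=> z.
have h1 : {for z, continuous (fun z : R * (R * R) => z.1)} by exact: cvg_fst.
have h2 := @snd_fst_cts R z.
have h3 := @snd_snd_cts R z.
exact: (cvg_pair h1 (cvg_pair h3 h2)).
Qed.

Lemma is_derive_swapN (R : realType) (f : R * (R * R) -> R) z v (a : R) :
  is_derive (swapx z) (swapx v) f a ->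
  is_derive z v (fun y => - f (swapx y)) (- a).
Proof.
move=> fa; suff H : is_derive z v (f \o swapx) a by apply: is_deriveN.
by case: fa => fd fa; split.
Qed.

Lemma jet_swapN (R : realType) (f : R * (R * R) -> R) D D2 :
  jet f D D2 ->
  jet (fun z => - f (swapx z)) (fun v z => - D (swapx v) (swapx z))
    (fun v w z => - D2 (swapx v) (swapx w) (swapx z)).
Proof.
have C (g : R * (R * R) -> R) : continuous g -> continuous (fun z => - g (swapx z)).
  move=> gc z; apply: cvgN; apply: (@cvg_comp _ _ _ swapx g).
    exact: swapx_cts.
  exact: gc.
move=> [f0 f1 f2 f3 f4]; split.
- exact: C.
- by move=> v z; apply: is_derive_swapN.
- by move=> v; exact: C.
- by move=> v w z; apply: is_derive_swapN.
- by move=> v w; exact: C.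
Qed.

Definition lform {R : realType} (a z : R * (R * R)) : R :=
  a.1 * z.1 + a.2.1 * z.2.1 + a.2.2 * z.2.2.

Lemma lform_cts (R : realType) (a : R * (R * R)) : continuous (lform a).
Proof.
move=> z; apply: cvgD; first apply: cvgD; apply: cvgMl_tmp.
- exact: cvg_fst.
- exact: snd_fst_cts.
- exact: snd_snd_cts.
Qed.

Lemma is_derive_ridge (R : realType) (f : R -> R) (df : R) a e z v :
  is_derive (lform a z + e) 1 f df ->
  is_derive z v (fun y => f (lform a y + e)) (df * lform a v).
Proof.
move=> fd.
(* [g] is the argument of [f] along the line [z + h v]. The difference quotients of [f \o g] at 0
   are those of the ridge function, so the one-variable chain rule is enough. *)
pose g h := h * lform a v + (lform a z + e).
have gd : is_derive (0 : R) 1 g (lform a v).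
  rewrite /g; apply: is_derive_eq.
  by rewrite /GRing.scale /= !(mulr1,mul1r,scaler0,mulr0,addr0,add0r).
have g0 : g 0 = lform a z + e by rewrite /g mul0r add0r.
have := @is_derive1_comp R f g 0 df (lform a v).
rewrite g0 => /(_ fd gd) [].
rewrite /derivable /derive => H1 H2.
have E : (fun h : R => h^-1 *: (((f \o g) \o shift 0) (h *: 1) - (f \o g) 0)) =
  (fun h : R => h^-1 *: (((fun y => f (lform a y + e)) \o shift z) (h *: v)
     - f (lform a z + e))).
  apply/funext => h /=; congr (_ *: (f _ - f _)) => //.
  have sE (x y : R) : x *: y = x * y by [].
  by rewrite /g /lform /= !sE; ring.
by rewrite E in H1 H2; split.
Qed.

Lemma jet_ridge (R : realType) (f f1 f2 : R -> R) a e :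
  (forall x : R, is_derive x 1 f (f1 x)) ->
  (forall x : R, is_derive x 1 f1 (f2 x)) ->
  continuous f2 ->
  jet (fun z => f (lform a z + e)) (fun v z => f1 (lform a z + e) * lform a v)
    (fun v w z => f2 (lform a z + e) * lform a w * lform a v).
Proof.
move=> h1 h2 c2.
have C (g : R -> R) : continuous g -> continuous (fun z => g (lform a z + e)).
  move=> gc z; apply: (@cvg_comp _ _ _ (fun z => lform a z + e) g).
    by apply: cvgD; [exact: lform_cts | exact: cvg_cst].
  exact: gc.
have C1 (g g1 : R -> R) : (forall x : R, is_derive x 1 g (g1 x)) -> continuous g.
  move=> d x; apply/differentiable_continuous/derivable1_diffP.
  exact: ex_derive.
split.
- exact/C/(C1 _ f1).
- by move=> v z; exact: is_derive_ridge.
- by move=> v z; apply: cvgMl; apply: C; exact: (C1 _ f2).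
- move=> v w z.
  have := is_deriveZ (lform a v) (@is_derive_ridge R f1 _ a e z w (h2 _)).
  rewrite /GRing.scale /= mulrC; congr (is_derive _ _ _ _).
  by apply/funext => y; rewrite mulrC.
- by move=> v w z; apply: cvgMl; apply: cvgMl; exact: C.
Qed.

(** * A smooth absolute value *)

Definition sabs {R : realType} (r x : R) : R := Num.sqrt (x ^+ 2 + r ^+ 2).

Section sabs.
Context (R : realType).
Implicit Types r x : R.

Lemma sabs_gt0 r x : 0 < r -> 0 < sabs r x.
Proof.
by move=> r0; rewrite sqrtr_gt0 ltr_wpDl ?sqr_ge0// exprn_gt0.
Qed.

Lemma sqr_sabs r x : sabs r x ^+ 2 = x ^+ 2 + r ^+ 2.
Proof. by rewrite sqr_sqrtr// addr_ge0// sqr_ge0. Qed.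

Lemma sabs_ge_norm r x : `|x| <= sabs r x.
Proof. by rewrite -sqrtr_sqr ler_wsqrtr// lerDl sqr_ge0. Qed.

Lemma sabs_le r x : 0 < r -> sabs r x <= `|x| + r.
Proof.
move=> r0; have := sabs_gt0 x r0 => s0.
have s1 := ltW s0; have q0 : 0 <= `|x| + r by rewrite addr_ge0// ltW.
rewrite -(@ler_pXn2r _ 2)//.
have p := mulr_ge0 (normr_ge0 x) (ltW r0).
have e : (`|x| + r) ^+ 2 = x ^+ 2 + r ^+ 2 + 2 * (`|x| * r).
  by rewrite -(real_normK (num_real x)); ring.
rewrite sqr_sabs e; lra.
Qed.

Lemma is_derive_sabs r x : 0 < r -> is_derive x 1 (sabs r) (x / sabs r x).
Proof.
move=> r0; have s0 := sabs_gt0 x r0.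
have h : 0 < x ^+ 2 + r ^+ 2 by rewrite -sqr_sabs exprn_gt0.
have := @is_derive1_comp R Num.sqrt (fun x => x ^+ 2 + r ^+ 2) x
  (2 * Num.sqrt (x ^+ 2 + r ^+ 2))^-1 (2 * x) (is_derive1_sqrt h).
have d : is_derive x 1 (fun x : R => x ^+ 2 + r ^+ 2) (2 * x).
  apply: is_derive_eq.
  have sE (a b : R) : a *: b = a * b by [].
  rewrite !sE; ring.
move=> /(_ d); rewrite -/(sabs r x).
congr (is_derive _ _ _ _); field.
by rewrite gt_eqF.
Qed.

Lemma is_derive_dsabs r x : 0 < r ->
  is_derive x 1 (fun x => x / sabs r x) (r ^+ 2 / sabs r x ^+ 3).
Proof.
move=> r0; have s0 := sabs_gt0 x r0.
have s0' : sabs r x != 0 by rewrite gt_eqF.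
have d := is_derive_sabs x r0.
have dV := @is_deriveV R _ _ _ _ s0' d.
have := is_deriveM (is_derive_id x (1 : R)) dV.
congr (is_derive _ _ _ _).
have sE (a b : R) : a *: b = a * b by [].
rewrite !sE; have := sqr_sabs r x.
move: s0'; move: (sabs r x) => s sn e.
have -> : r ^+ 2 = s ^+ 2 - x ^+ 2 by rewrite e; ring.
by field.
Qed.

Lemma sabs_cts r : 0 < r -> continuous (sabs r).
Proof.
move=> r0 x; apply/differentiable_continuous/derivable1_diffP.
by have [] := is_derive_sabs x r0.
Qed.

Lemma ddsabs_cts r : 0 < r -> continuous (fun x => r ^+ 2 / sabs r x ^+ 3).
Proof.
move=> r0 x; apply: cvgMl_tmp; apply: cvgV.
  by rewrite expf_neq0// gt_eqF// sabs_gt0.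
by apply: (@cvg_comp _ _ _ (sabs r) (fun y => y ^+ 3));
  [exact: sabs_cts | exact: exprn_continuous].
Qed.

Lemma dsabs_norm_lt1 r x : 0 < r -> `|x / sabs r x| < 1.
Proof.
move=> r0; have s0 := sabs_gt0 x r0.
rewrite normrM normfV [X in _ / X]gtr0_norm// ltr_pdivrMr// mul1r.
have s1 := ltW s0.
rewrite -(@ltr_pXn2r _ 2)// sqr_sabs real_normK ?num_real//.
by rewrite ltrDl exprn_gt0.
Qed.

Lemma ddsabs_bound r x : 0 < r -> 0 <= r ^+ 2 / sabs r x ^+ 3 <= r^-1.
Proof.
move=> r0; have s0 := sabs_gt0 x r0.
rewrite divr_ge0 ?exprn_ge0 ?(ltW r0) ?(ltW s0)//=.
rewrite ler_pdivrMr ?exprn_gt0// mulrC ler_pdivlMr//.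
rewrite -exprSr lerXn2r// ?nnegrE ?(ltW r0) ?(ltW s0)//.
have r1 := ltW r0; have s1 := ltW s0.
by rewrite -(@ler_pXn2r _ 2)// sqr_sabs lerDr sqr_ge0.
Qed.

(** At [x = 4 r / 3] the numbers [r], [x], [sabs r x] are proportional to 3, 4, 5, and the slope
    increases with [x]. *)
Lemma dsabs_ge r x : 0 < r -> 4 / 3 * r <= x -> 4 / 5 <= x / sabs r x.
Proof.
move=> r0 xr; have s0 := sabs_gt0 x r0.
rewrite ler_pdivlMr// -(@ler_pXn2r _ 2)// ?nnegrE; [|nra|nra].
rewrite exprMn sqr_sabs; nra.
Qed.

End sabs.

(** * The barrier *)

(* [y0, s0] is the rescaled centre, [7 / eta] a lower bound for the half-width of the
   tube.  With [S r x = sqrt (x^2 + r^2)] the witness is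
   [(al + 3) t - 9/2 + de t^n + 3/2 S r (x2 - s0)
      + 3/4 (S rho (2t + (x1 - y0) - 3) + S rho (2t - (x1 - y0) - 3))]:
   the second term in [S] penalizes leaving the tube sideways, the last two are fronts
   entering from its ends at speed 2, and [de t^n] is small at time 1 but exceeds [M]
   at time 2, which replaces a singular penalization of the final time (test
   functions must be smooth for all positive times). *)
Lemma barrier (R : realType) (eta y0 s0 eps M : R) :
  0 < eta < 2^-1 -> 0 < eps <= eta ^+ 2 / 1024 -> 0 <= y0 <= eta / 32 ->
  0 <= s0 <= eta / 32 -> 0 <= M ->
  exists w D D2, [/\ jet w D D2,
    (forall x, 0 <= w (0, x)) /\ w (1, (0, 0)) <= - 2^-1 + eta,
    forall x, M < w (2, x),
    forall t x, 0 <= t -> M + 5 <= `|x.1 - y0| \/ M + 5 <= `|x.2 - s0| ->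
      M < w (t, x) &
    forall z, 0 < z.1 -> [/\ `|D (e_1 R) z| <= 2, `|D (e_2 R) z| <= 2 &
      forall c, c <= 2^-1 ->
        (`|z.2.1 - y0| <= 4 -> `|z.2.2 - s0| <= eps * (7 / eta) ->
         c <= - 2^-1) ->
        c < D (e_t R) z + `|D (e_2 R) z| - `|D (e_1 R) z|
            - eps * (D2 (e_1 R) (e_1 R) z + D2 (e_2 R) (e_2 R) z)]].
Proof.
move=> /andP[eta0 eta1] /andP[eps0 eps1] /andP[y00 y01] /andP[s00 s01] M0.
(* With this [r] the curvature across the tube costs [eps * (3 / 2) / r = 3/8 eta]; the fronts cost
   at most [3/64 eta]. The total [27/64 eta] is below the margin [eta / 2] put in [al]; the other
   [eta / 2] absorbs, at time 1, [de] and the errors of smoothing and centring. *)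
pose de := eta / 8; pose rho := eta / 32; pose r := eps * (4 / eta).
have de0 : 0 < de by rewrite /de; lra.
have rho0 : 0 < rho by rewrite /rho; lra.
have r0 : 0 < r by rewrite /r mulr_gt0// divr_gt0.
have [N HN] : exists N : nat, M < de * 2 ^+ N.+2.
  exists (Num.truncn (M / de)); rewrite mulrC -ltr_pdivrMr//.
  apply: lt_trans (truncnS_gt _) _; rewrite -natrX ltr_nat.
  exact/ltnW/ltn_expl.
have sE (a b : R) : a *: b = a * b by [].
pose al := - 2^-1 + eta / 2.
pose f1 x := (al + 3) * x - 9 / 2 + de * x ^+ N.+2.
pose f1' x := (al + 3) + de * (N.+2%:R * x ^+ N.+1).
pose f1'' x := de * (N.+2%:R * (N.+1%:R * x ^+ N)) : R.
have dX n (x : R) : is_derive x 1 (fun y => y ^+ n.+1) (n.+1%:R * x ^+ n).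
  by have := is_deriveX n.+1 (is_derive_id x (1 : R)); rewrite !sE mulr1 exprfctE.
have J1 : jet (fun z => f1 (lform (1, (0, 0)) z + 0))
    (fun v z => f1' (lform (1, (0, 0)) z + 0) * lform (1, (0, 0)) v)
    (fun v w z => f1'' (lform (1, (0, 0)) z + 0) * lform (1, (0, 0)) w
       * lform (1, (0, 0)) v).
  apply: jet_ridge.
  - move=> x.
    have := is_deriveD (is_deriveB (is_deriveZ (al + 3) (is_derive_id x (1 : R)))
      (is_derive_cst (9 / 2 : R) x 1)) (is_deriveZ de (dX N.+1 x)).
    by rewrite !sE mulr1 subr0.
  - move=> x.
    have := is_deriveD (is_derive_cst (al + 3 : R) x 1)
      (is_deriveZ de (is_deriveZ N.+2%:R (dX N x))).
    by rewrite !sE add0r.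
  - move=> x; apply: cvgMl_tmp; apply: cvgMl_tmp; apply: cvgMl_tmp.
    exact: exprn_continuous.
have J a e p (k : R) : 0 < p -> jet (fun z => k * sabs p (lform a z + e))
    (fun v z => k * ((lform a z + e) / sabs p (lform a z + e)) * lform a v)
    (fun v w z => k * (p ^+ 2 / sabs p (lform a z + e) ^+ 3) *
         lform a w * lform a v).
  move=> p0; apply: (@jet_ridge R (fun x => k * sabs p x)
    (fun x => k * (x / sabs p x)) (fun x => k * (p ^+ 2 / sabs p x ^+ 3))).
  - by move=> x; have d := is_derive_sabs x p0; have := is_deriveZ k d.
  - by move=> x; have d := is_derive_dsabs x p0; have := is_deriveZ k d.
  - by move=> x; apply: cvgMl_tmp; apply: ddsabs_cts.
have J2 := J (0, (0, 1)) (- s0) r (3 / 2) r0.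
have J3 := J (2, (1, 0)) (- y0 - 3) rho (3 / 4) rho0.
have J4 := J (2, (-1, 0)) (y0 - 3) rho (3 / 4) rho0.
have := jetD (jetD J1 J2) (jetD J3 J4).
set w := fun z => _; set D := fun v z => _; set D2 := fun v w z => _ => JJ.
exists w, D, D2.
have wE t x : w (t, x) = (al + 3) * t - 9 / 2 + de * t ^+ N.+2
   + 3 / 2 * sabs r (x.2 - s0)
   + (3 / 4 * sabs rho (2 * t + (x.1 - y0) - 3)
   + 3 / 4 * sabs rho (2 * t - (x.1 - y0) - 3)).
  rewrite /w /lform /f1 /=.
  by congr (_ * _ - _ + _ * _ ^+ _ + _ * sabs _ _ + (_ * sabs _ _ + _ * sabs _ _));
    ring.
have ab (a : R) : a <= `|a| /\ - a <= `|a|.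
  by split; [exact: ler_norm | rewrite -normrN ler_norm].
split => //.
- split.
    (* The two fronts contribute at least [3/4 * 6], which cancels [- 9/2] exactly. *)
    move=> x; rewrite wE expr0n /= !mulr0 add0r.
    have := sabs_gt0 (x.2 - s0) r0.
    have [] := ab (0 + (x.1 - y0) - 3); have [] := ab (0 - (x.1 - y0) - 3).
    have := sabs_ge_norm rho (0 + (x.1 - y0) - 3).
    have := sabs_ge_norm rho (0 - (x.1 - y0) - 3).
    lra.
  rewrite wE expr1n /=.
  have := sabs_le (0 - s0) r0; rewrite sub0r normrN ger0_norm//.
  have := sabs_le (2 * 1 + (0 - y0) - 3) rho0.
  rewrite ler0_norm; last by lra.
  have := sabs_le (2 * 1 - (0 - y0) - 3) rho0.
  rewrite ler0_norm; last by lra.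
  have rl : r <= eta / 256.
    rewrite /r mulrA ler_pdivrMr//; lra.
  rewrite /al /de; rewrite /rho; lra.
- move=> x; rewrite wE.
  have := sabs_gt0 (x.2 - s0) r0.
  have [] := ab (2 * 2 + (x.1 - y0) - 3); have [] := ab (2 * 2 - (x.1 - y0) - 3).
  have := sabs_ge_norm rho (2 * 2 + (x.1 - y0) - 3).
  have := sabs_ge_norm rho (2 * 2 - (x.1 - y0) - 3).
  rewrite /al; lra.
- move=> t x t0 H; rewrite wE.
  have := sabs_ge_norm r (x.2 - s0).
  have [] := ab (2 * t + (x.1 - y0) - 3); have [] := ab (2 * t - (x.1 - y0) - 3).
  have := sabs_ge_norm rho (2 * t + (x.1 - y0) - 3).
  have := sabs_ge_norm rho (2 * t - (x.1 - y0) - 3).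
  have p1 : 0 <= (al + 3) * t by rewrite mulr_ge0// /al; lra.
  have p2 : 0 <= de * t ^+ N.+2 by rewrite mulr_ge0 ?exprn_ge0// ltW.
  have := normr_ge0 (x.2 - s0).
  case: H => H.
    have [h|h] := lerP 0 (x.1 - y0).
      by rewrite ger0_norm// in H; lra.
    by rewrite ltr0_norm// in H; lra.
  lra.
- case=> t [x1 x2] /= t0.
set P := (lform (2, (1, 0)) (t, (x1, x2)) + (- y0 - 3))
  / sabs rho (lform (2, (1, 0)) (t, (x1, x2)) + (- y0 - 3)).
set Q := (lform (2, (-1, 0)) (t, (x1, x2)) + (y0 - 3))
  / sabs rho (lform (2, (-1, 0)) (t, (x1, x2)) + (y0 - 3)).
set S := (lform (0, (0, 1)) (t, (x1, x2)) + (- s0))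
  / sabs r (lform (0, (0, 1)) (t, (x1, x2)) + (- s0)).
have Dt : D (e_t R) (t, (x1, x2)) = f1' t + 3 / 2 * (P + Q).
  rewrite /D -/P -/Q -/S; rewrite {1}/lform /= /lform /=.
  have -> : 1 * t + 0 * x1 + 0 * x2 + 0 = t by ring.
  by move: (P) (Q) (S) (f1' t) => P' Q' S' F; field.
have D1 : D (e_1 R) (t, (x1, x2)) = 3 / 4 * (P - Q).
  rewrite /D -/P -/Q -/S /lform /=.
  by move: (P) (Q) (S) (f1' _) => P' Q' S' F; ring.
have D2' : D (e_2 R) (t, (x1, x2)) = 3 / 2 * S.
  rewrite /D -/P -/Q -/S /lform /=.
  by move: (P) (Q) (S) (f1' _) => P' Q' S' F; ring.
have Lap : eps * (D2 (e_1 R) (e_1 R) (t, (x1, x2)) +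
    D2 (e_2 R) (e_2 R) (t, (x1, x2))) <= 27 / 64 * eta.
  rewrite /D2.
  have := ddsabs_bound (lform (2, (1, 0)) (t, (x1, x2)) + (- y0 - 3)) rho0.
  have := ddsabs_bound (lform (2, (-1, 0)) (t, (x1, x2)) + (y0 - 3)) rho0.
  have := ddsabs_bound (lform (0, (0, 1)) (t, (x1, x2)) + (- s0)) r0.
  move: (_ / sabs _ _ ^+ 3) => q /andP[q0 q1].
  move: (_ / sabs _ _ ^+ 3) => p /andP[p0 p1].
  move: (_ / sabs _ _ ^+ 3) => p' /andP[p'0 p'1].
  rewrite /lform /=; move: (f1'' _) => F.
  set X := (X in eps * X).
  have -> : X = 3 / 4 * (p + p') + 3 / 2 * q by rewrite /X; ring.
  have h1 : eps * rho^-1 <= eta / 32.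
    rewrite ler_pdivrMr// /rho; lra.
  have h2 : eps * r^-1 = eta / 4 by rewrite /r; field; rewrite !gt_eqF.
  have h3 : eps * p <= eps * rho^-1 by rewrite ler_pM2l.
  have h4 : eps * p' <= eps * rho^-1 by rewrite ler_pM2l.
  have h5 : eps * q <= eps * r^-1 by rewrite ler_pM2l.
  rewrite mulrDr (mulrCA _ (3 / 4)) (mulrCA _ (3 / 2)) mulrDr; lra.
have F1 : al + 3 <= f1' t.
  by rewrite /f1' lerDl !mulr_ge0 ?exprn_ge0// ltW.
have := dsabs_norm_lt1 (lform (2, (1, 0)) (t, (x1, x2)) + (- y0 - 3)) rho0.
rewrite -/P ltr_norml => /andP[P0 P1].
have := dsabs_norm_lt1 (lform (2, (-1, 0)) (t, (x1, x2)) + (y0 - 3)) rho0.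
rewrite -/Q ltr_norml => /andP[Q0 Q1].
have := dsabs_norm_lt1 (lform (0, (0, 1)) (t, (x1, x2)) + (- s0)) r0.
rewrite -/S => S1.
have D1n : `|D (e_1 R) (t, (x1, x2))| <= 3 / 4 * (2 + P + Q).
  rewrite D1 (normrM (3 / 4) (P - Q)) gtr0_norm// ler_pM2l// ler_norml; lra.
have D2n : `|D (e_2 R) (t, (x1, x2))| = 3 / 2 * `|S|.
  by rewrite D2' (normrM (3 / 2) S) gtr0_norm.
split; first by rewrite D1 ler_norml; lra.
  rewrite D2n; lra.
move=> c c1 c2; rewrite Dt.
move: Lap; move: (eps * (_ + _)) => L Lap.
(* Since [P, Q > -1], [|P - Q| <= 2 + P + Q]: the fronts move at speed 2, so half of their time
   derivative pays for the gradient along [x_1]. Three regions remain: beside the tube, in it, and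
   past its ends. *)
suff : c < al + 3 / 2 + 3 / 4 * (P + Q) + `|D (e_2 R) (t, (x1, x2))|
   - 27 / 64 * eta by lra.
have [h2|h2] := lerP `|x2 - s0| (eps * (7 / eta)); last first.
  (* The sideways slope [3/2 * 4/5] exceeds 1, the largest oscillation of the weight. It is reached
     off the tube because [4/3 r <= 7 eps / eta]. *)
  suff : 4 / 5 <= `|S| by rewrite D2n /al; lra.
  have -> : `|S| = `|x2 - s0| / sabs r `|x2 - s0|.
    rewrite normrM normfV [`|sabs _ _|]gtr0_norm ?sabs_gt0//.
    rewrite /sabs real_normK ?num_real// /lform /=.
    by have -> : 0 * t + 0 * x1 + 1 * x2 + - s0 = x2 - s0 by ring.
  apply: dsabs_ge => //; apply: le_trans (ltW h2).
  rewrite /r mulrCA ler_pM2l// mulrA ler_pM2r ?invr_gt0//; lra.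
have [h1|h1] := lerP `|x1 - y0| 4.
  by have := c2 h1 h2; have := normr_ge0 (D (e_2 R) (t, (x1, x2))); rewrite /al; lra.
(* Past an end one front has slope at least [4/5] and the other more than [-1], so
   [3/2 + 3/4 (P + Q)] exceeds [27/20], again more than the oscillation of the weight. *)
have : 4 / 5 <= P \/ 4 / 5 <= Q.
  have [h|h] := lerP 0 (x1 - y0).
    left; apply: dsabs_ge => //; rewrite ger0_norm// in h1.
    rewrite /lform /= /rho; lra.
  right; apply: dsabs_ge => //; rewrite ltr0_norm// in h1.
  rewrite /lform /= /rho; lra.
have := normr_ge0 (D (e_2 R) (t, (x1, x2))); rewrite /al.
move: (`|_|) => N2 N20 [h|h]; lra.
Qed.

(** * Comparison *)

(** The function is nonpositive on all faces of the box [[0, 2] x [-B, B]^2], so a positive value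
    forces the maximum over this compact set into the interior, where it is a local maximum. *)
Lemma interior_max (R : realType) (v : R * (R * R) -> R) (z1 : R * (R * R)) (B : R) :
  {within [set z : R * (R * R) | 0 <= z.1], continuous v} ->
  (forall x, v (0, x) <= 0) -> (forall x, v (2, x) <= 0) ->
  (forall t x, 0 <= t <= 2 -> B <= `|x.1| \/ B <= `|x.2| -> v (t, x) <= 0) ->
  0 <= z1.1 <= 2 -> 0 < v z1 ->
  exists z : R * (R * R), 0 < z.1 /\ \forall y \near z, v y <= v z.
Proof.
move=> vc v0 v2 vB z12 vz1.
pose K := `[0, 2]%classic `*` (`[- B, B]%classic `*` `[- B, B]%classic)
  : set (R * (R * R)).
have inK (z : R * (R * R)) : 0 <= z.1 <= 2 -> 0 < v z ->
    [/\ 0 < z.1, z.1 < 2, `|z.2.1| < B & `|z.2.2| < B].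
  case: z => t x /= t02 vz; have /andP[t0 t2] := t02; split.
  - rewrite lt_neqAle t0 andbT; apply/eqP => h.
    by move: vz; rewrite -h ltNge v0.
  - rewrite lt_neqAle t2 andbT; apply/eqP => h.
    by move: vz; rewrite h ltNge v2.
  - by rewrite ltNge; apply/negP => h; move: vz; rewrite ltNge vB//; left.
  - by rewrite ltNge; apply/negP => h; move: vz; rewrite ltNge vB//; right.
have Kz (z : R * (R * R)) : 0 <= z.1 <= 2 -> `|z.2.1| < B -> `|z.2.2| < B -> K z.
  by move=> h1 /ltW h2 /ltW h3; rewrite /K /= !in_itv /= -!ler_norml.
have K1 : K z1 by have [] := inK _ z12 vz1 => *; exact: Kz.
have cK : compact K.
  by apply: compact_setX; [|apply: compact_setX]; exact: segment_compact.
have cv : {within K, continuous v}.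
  apply: continuous_subspaceW vc => z [/=].
  by rewrite in_itv /= => /andP[].
have [z /set_mem Hz zmax] := compact_EVT_max (ex_intro _ _ K1) cK cv.
have z02 : 0 <= z.1 <= 2 by case: Hz => /=; rewrite in_itv.
have vz : 0 < v z by apply: lt_le_trans vz1 (zmax _ _); exact/mem_set.
have [z0 z2 zB1 zB2] := inK _ z02 vz.
exists z; split => //.
have c1 : {for z, continuous (fun y : R * (R * R) => y.1)} by exact: cvg_fst.
near=> y; apply: zmax; apply/mem_set; apply: Kz.
- apply/andP; split; apply: ltW; near: y.
  + exact: cvgr_gt c1 _ z0.
  + exact: cvgr_lt c1 _ z2.
- near: y; exact: cvgr_norm_lt (@snd_fst_cts R z) _ zB1.
- near: y; exact: cvgr_norm_lt (@snd_snd_cts R z) _ zB2.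
Unshelve. all: by end_near. Qed.

Lemma hamiltonian_small (R : realType) (q : R) c (p x : R * R) : 1 < q ->
  `|p.1| <= 2 -> `|p.2| <= 2 ->
  hamiltonian q c p x = - c x + `|p.2| - `|p.1|.
Proof.
move=> q1 p1 p2; rewrite /hamiltonian.
have -> : Num.max (Num.max `|p.1| `|p.2| - 2) 0 = 0.
  by apply/max_idPr; rewrite subr_le0 ge_max p1.
by rewrite powR0 ?addr0// gt_eqF// (lt_trans ltr01).
Qed.

Lemma solution_le (R : realType) (eta y0 s0 eps q : R) (c : R * R -> R) u :
  0 < eta < 2^-1 -> 0 < eps <= eta ^+ 2 / 1024 -> 0 <= y0 <= eta / 32 ->
  0 <= s0 <= eta / 32 -> 1 < q ->
  (forall x, c x <= 2^-1) ->
  (forall x, `|x.1 - y0| <= 4 -> `|x.2 - s0| <= eps * (7 / eta) ->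
     c (x.1 / eps, x.2 / eps) <= - 2^-1) ->
  viscosity_solution eps
    (fun p x => hamiltonian q c p (x.1 / eps, x.2 / eps)) u ->
  u (1, (0, 0)) <= - 2^-1 + eta.
Proof.
move=> heta heps hy0 hs0 hq c1 c2 [uc usub _ u0 ub].
have [|M0 hM0] := ub 2; first by [].
pose M := Num.max M0 0.
have M00 : 0 <= M by rewrite le_max lexx orbT.
have hM t x : 0 <= t <= 2 -> u (t, x) <= M.
  move=> t02; rewrite le_max (le_trans (ler_norm _) (hM0 _ _ t02))//.
have [w [D [D2 [J [w0 w1] w2 wB wr]]]] := barrier heta heps hy0 hs0 M00.
have [wc _ _ _ _] := J.
apply: le_trans w1; rewrite leNgt; apply/negP => uw.
(* The box is centred at the origin whereas [w] is coercive around [(y0, s0)]; [Num.max y0 s0]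
   accounts for the shift. *)
have [||||||z [z0 zmax]] := @interior_max R (fun z => u z - w z) (1, (0, 0))
  (M + 5 + Num.max y0 s0).
- by move=> z; apply: cvgB; [exact: uc | apply: continuous_subspaceT].
- by move=> x; rewrite u0 subr_le0.
- by move=> x; rewrite subr_le0 (le_trans (hM _ _ _) (ltW (w2 _)))//= ler0n lexx.
- move=> t x t02 H; rewrite subr_le0 (le_trans (hM _ _ t02))// ltW//.
  apply: wB; first by case/andP: t02.
  have /andP[y00 _] := hy0; have /andP[s00 _] := hs0.
  have m1 : y0 <= Num.max y0 s0 by rewrite le_max lexx.
  have m2 : s0 <= Num.max y0 s0 by rewrite le_max lexx orbT.
  case: H => H; [left|right].
    by have := lerB_dist x.1 y0; rewrite (ger0_norm y00); lra.
  by have := lerB_dist x.2 s0; rewrite (ger0_norm s00); lra.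
- by rewrite /= ler01 ler1n.
- by rewrite subr_gt0.
have := usub w z (jet_C12 J) z0 zmax.
rewrite (residual_jet _ _ _ J).
have [d1 d2 /(_ (c (z.2.1 / eps, z.2.2 / eps)))] := wr z z0.
move=> /(_ (c1 _) (c2 _)); rewrite hamiltonian_small//=.
move: (D (e_t R) z) (`|D (e_2 R) z|) (`|D (e_1 R) z|) => a b d.
move: (eps * _) => e; lra.
Qed.

Lemma solution_ge (R : realType) (eta y0 s0 eps q : R) (c : R * R -> R) u :
  0 < eta < 2^-1 -> 0 < eps <= eta ^+ 2 / 1024 -> 0 <= y0 <= eta / 32 ->
  0 <= s0 <= eta / 32 -> 1 < q ->
  (forall x, - 2^-1 <= c x) ->
  (forall x, `|x.2 - y0| <= 4 -> `|x.1 - s0| <= eps * (7 / eta) ->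
     2^-1 <= c (x.1 / eps, x.2 / eps)) ->
  viscosity_solution eps
    (fun p x => hamiltonian q c p (x.1 / eps, x.2 / eps)) u ->
  2^-1 - eta <= u (1, (0, 0)).
Proof.
move=> heta heps hy0 hs0 hq c1 c2 [uc _ usup u0 ub].
have [|M0 hM0] := ub 2; first by [].
pose M := Num.max M0 0.
have M00 : 0 <= M by rewrite le_max lexx orbT.
have hM t x : 0 <= t <= 2 -> - u (t, x) <= M.
  by move=> t02; rewrite le_max (le_trans (ler_norm _))// normrN hM0.
have [w [D [D2 [J [w0 w1] w2 wB wr]]]] := barrier heta heps hy0 hs0 M00.
have Js := jet_swapN J; have [wc _ _ _ _] := Js.
rewrite leNgt; apply/negP => uw.
have [||||||z [z0 zmax]] := @interior_max R (fun z => - w (swapx z) - u z)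
  (1, (0, 0)) (M + 5 + Num.max y0 s0).
- have wc' : {within [set z : R * (R * R) | 0 <= z.1],
      continuous (fun z => - w (swapx z))} by exact: continuous_subspaceT.
  by move=> z; apply: cvgB; [exact: wc' | exact: uc].
- by move=> x; rewrite u0 subr0 oppr_le0; exact: w0.
- move=> x; have h2 : ((0 : R) <= (2 : R)) && ((2 : R) <= (2 : R)) by rewrite ler0n /=.
  by have := hM 2 x h2; have := w2 (x.2, x.1); rewrite /swapx /=; lra.
- move=> t x t02 H; suff : M < w (t, (x.2, x.1)).
    by have := hM _ x t02; rewrite /swapx /=; lra.
  apply: wB; first by case/andP: t02.
  have /andP[y00 _] := hy0; have /andP[s00 _] := hs0.
  have m1 : y0 <= Num.max y0 s0 by rewrite le_max lexx.
  have m2 : s0 <= Num.max y0 s0 by rewrite le_max lexx orbT.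
  case: H => H; [right|left].
    by have := lerB_dist x.1 s0; rewrite (ger0_norm s00) /=; lra.
  by have := lerB_dist x.2 y0; rewrite (ger0_norm y00) /=; lra.
- by rewrite /= ler01 ler1n.
- by move: w1; rewrite /swapx /=; lra.
have zmin : \forall y \near z, u z - - w (swapx z) <= u y - - w (swapx y).
  by apply: filterS zmax => y; lra.
have := usup _ z (jet_C12 Js) z0 zmin.
rewrite (residual_jet _ _ _ Js).
(* The strict inequality of the barrier is read at the reflected point with the opposite weight;
   [swapx] exchanges [e_1] and [e_2] and fixes [e_t]. *)
have [d1 d2 /(_ (- c (z.2.1 / eps, z.2.2 / eps)))] := wr (swapx z) z0.
have -> : swapx (e_t R) = e_t R by [].
have -> : swapx (e_1 R) = e_2 R by [].
have -> : swapx (e_2 R) = e_1 R by [].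
have cN : - c (z.2.1 / eps, z.2.2 / eps) <= 2^-1 by rewrite lerNl.
have cT : `|(swapx z).2.1 - y0| <= 4 ->
    `|(swapx z).2.2 - s0| <= eps * (7 / eta) ->
    - c (z.2.1 / eps, z.2.2 / eps) <= - 2^-1.
  by move=> a b; rewrite lerN2; exact: c2.
move=> /(_ cN cT) h; rewrite hamiltonian_small//= ?normrN//.
move: h; move: (D (e_t R) _) (`|D (e_2 R) _|) (`|D (e_1 R) _|) => a b d.
move: (D2 _ _ _) (D2 _ _ _) => k l; lra.
Qed.

(** * The weight near a good rectangle *)

Lemma limn_eventually (R : realType) (s : nat -> R) n (a : R) :
  (forall m, (n <= m)%N -> s m = a) -> limn s = a.
Proof.
move=> h; apply: lim_near_cst => //.
by exists n => // m /= nm; rewrite h.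
Qed.

(** The interval contains 0, the default limit of a divergent sequence; hence the weight is bounded
    for every realization. *)
Lemma limn_bounded (R : realType) (s : nat -> R) (a b : R) : a <= 0 <= b ->
  (forall n, a <= s n <= b) -> a <= limn s <= b.
Proof.
move=> ab h; have [cs|ncs] := pselect (cvgn s); last first.
  by rewrite (dvgP ncs).
by rewrite limr_ge ?limr_le//; apply: nearW => n; case/andP: (h n).
Qed.

Section random_weight.
Context (R : realType) (lambda mu : R) (xi : nat -> nat -> int -> int -> bool).
Local Notation hor := (in_horizontal lambda mu xi).
Local Notation ver := (in_vertical lambda mu xi).
Local Notation c1 := (c1 lambda mu xi).
Local Notation c2 := (c2 lambda mu xi).
Local Notation weight := (weight lambda mu xi).
Implicit Types x y : R * R.

Lemma half_ge0 : - 2^-1 <= (0 : R) <= 2^-1.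
Proof. by rewrite oppr_le0 invr_ge0 ler0n. Qed.

Lemma c1_bounded x : - 2^-1 <= c1 x <= 2^-1.
Proof.
apply: limn_bounded; first exact: half_ge0.
by elim=> [|n IH] /=; [exact: half_ge0 | case: ifP => //; lra].
Qed.

Lemma c2_bounded x : - 2^-1 <= c2 x <= 2^-1.
Proof.
apply: limn_bounded; first exact: half_ge0.
elim=> [|n IH] /=; first exact: c1_bounded.
by do 3?case: ifP => // _; lra.
Qed.

(** Vertical rectangles of level below [k] are blocked at [x] by the horizontal one, so phase 2
    never acts there; in phase 1 any later step at [x] writes the same value. *)
Lemma c2_hor k x : (0 < k)%N -> hor k x ->
  (forall k', (k <= k')%N -> ~ ver k' x) -> c2 x = - 2^-1.
Proof.
case: k => // k _ hk hv.
have -> : c2 x = c1 x.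
  apply: (@limn_eventually _ _ 0) => n _; elim: n => //= n ->.
  case: ifPn => // /asboolP vn; case: ifPn => // /asboolP[]; exists k.+1.
  by split => //; rewrite ltnNge; apply/negP => /hv.
apply: (@limn_eventually _ _ k.+1) => n; elim: n => // n IH.
rewrite leq_eqVlt ltnS => /predU1P[[<-]|/IH /= ->]; last by rewrite if_same.
by rewrite /= ifT//; apply/asboolP.
Qed.

(** Stage [k] overwrites whatever was there, since no horizontal rectangle of level at least [k]
    protects [x]; later vertical steps can only write the same value again. *)
Lemma c2_ver k x : (0 < k)%N -> ver k x ->
  (forall k', (k <= k')%N -> ~ hor k' x) -> c2 x = 2^-1.
Proof.
case: k => // k _ vk hh.
apply: (@limn_eventually _ _ k.+1) => n; elim: n => // n IH nk.
have h1 : ~ hor n.+1 x by exact: hh.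
have h2 : ~ exists k', (n.+1 < k')%N /\ hor k' x.
  by case=> k' [/ltnW h]; apply: hh; exact: leq_trans h.
rewrite /= (asboolF h1) (asboolF h2).
move: nk; rewrite leq_eqVlt ltnS => /predU1P[[<-]|/IH ->]; last by rewrite if_same.
by rewrite ifT//; apply/asboolP.
Qed.

Lemma euclid0 : euclid (0 : R * R) = 0.
Proof. by rewrite /euclid /= expr0n addr0 sqrtr0. Qed.

Lemma euclid_ge x : `|x.1| <= euclid x /\ `|x.2| <= euclid x.
Proof.
by split; rewrite -sqrtr_sqr ler_wsqrtr// ?lerDl ?lerDr sqr_ge0.
Qed.

Lemma inf_conv_le x :
  inf [set c2 y + euclid (x - y) | y in [set: R * R]] <= c2 x.
Proof.
apply: ge_inf; last by exists x => //; rewrite subrr euclid0 addr0.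
exists (- 2^-1) => _ [y _ <-]; have /andP[h _] := c2_bounded y.
by have [] := euclid_ge (x - y); have := normr_ge0 (x - y).1; lra.
Qed.

Lemma sup_conv_ge x :
  c2 x <= sup [set c2 y - euclid (x - y) | y in [set: R * R]].
Proof.
apply: ub_le_sup; last by exists x => //; rewrite subrr euclid0 subr0.
exists (2^-1) => _ [y _ <-]; have /andP[_ h] := c2_bounded y.
by have [] := euclid_ge (x - y); have := normr_ge0 (x - y).1; lra.
Qed.

Lemma weight_bounded x : - 2^-1 <= weight x <= 2^-1.
Proof.
have /andP[h1 h2] := c2_bounded x; have /andP[a b] := half_ge0.
rewrite /Defs.weight; case: ifP => _; apply/andP; split.
- by rewrite le_max a orbT.
- by rewrite ge_max b (le_trans (inf_conv_le x)).
- by rewrite le_min a (le_trans h1 (sup_conv_ge x)).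
- by rewrite ge_min b orbT.
Qed.

(** Radius 1 suffices because [c2] oscillates by at most 1: farther points cannot lift the
    sup-convolution above [-1/2]. *)
Lemma weight_le x : (forall y, euclid (x - y) < 1 -> c2 y = - 2^-1) ->
  weight x <= - 2^-1.
Proof.
move=> h; have cx : c2 x = - 2^-1 by apply: h; rewrite subrr euclid0 ltr01.
rewrite /Defs.weight cx ifF; last by apply/negbTE; rewrite -ltNge oppr_lt0 invr_gt0.
rewrite ge_min; apply/orP; left; apply: ge_sup.
  by exists (c2 x - euclid (x - x)), x.
move=> _ [y _ <-]; have [e1|e1] := ltP (euclid (x - y)) 1.
  by rewrite h// gerBl sqrtr_ge0.
by have /andP[_] := c2_bounded y; lra.
Qed.

Lemma weight_ge x : (forall y, euclid (x - y) < 1 -> c2 y = 2^-1) ->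
  2^-1 <= weight x.
Proof.
move=> h; have cx : c2 x = 2^-1 by apply: h; rewrite subrr euclid0 ltr01.
rewrite /Defs.weight cx ifT ?invr_ge0//.
rewrite le_max; apply/orP; left; apply: lb_le_inf.
  by exists (c2 x + euclid (x - x)), x.
move=> _ [y _ <-]; have [e1|e1] := ltP (euclid (x - y)) 1.
  by rewrite h// lerDl sqrtr_ge0.
by have /andP[] := c2_bounded y; lra.
Qed.

End random_weight.

(* Contains the centres of all level-[k'] rectangles of the family [3 - j] that meet the
   region of size a few [T_k] around the origin, as soon as [2^c] dominates [lambda]
   and [mu]. *)
Definition hit (c j k k' : nat) (l m : int) : bool :=
  if j == 1%N then (`|l| <= 2 ^ (k + c))%N && (`|m| <= 2 ^ (k' + c))%N
  else (`|m| <= 2 ^ (k + c))%N && (`|l| <= 2 ^ (k' + c))%N.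

(** In macroscopic units the coordinates of the centre are below [2 ^- s]; looking in one quadrant
    keeps a positive proportion of the candidates. The opposing family is [3 - j]. *)
Definition good (c s j k : nat) (xi : nat -> nat -> int -> int -> bool) : Prop :=
  (exists l m : nat, [/\ (l < 2 ^ (k - s))%N, (m < 2 ^ (k - s))%N &
    xi j k l%:Z m%:Z]) /\
  forall k' l m, (k <= k')%N -> hit c j k k' l m -> ~~ xi (3 - j)%N k' l m.

Lemma absz_le_scale (R : realType) (l : int) k c (b : R) :
  `|l%:~R| <= b * scale R k -> b <= 2 ^+ c -> (`|l| <= 2 ^ (k + c))%N.
Proof.
move=> h1 h2; rewrite -(ler_nat R) natr_absz intr_norm addnC expnD natrM !natrX.
by apply: le_trans h1 _; rewrite ler_wpM2r// exprn_ge0.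
Qed.

Lemma scale_ge1 (R : realType) k : 1 <= scale R k.
Proof. by rewrite exprn_ege1// ler1n. Qed.

Lemma lt_scale (R : realType) (l s k : nat) :
  (l < 2 ^ (k - s))%N -> 0 <= l%:R :> R /\ l%:R <= scale R k :> R.
Proof.
move=> h; split; first exact: ler0n.
rewrite /scale -natrX ler_nat; apply/ltnW/(leq_trans h).
by rewrite leq_exp2l// leq_subr.
Qed.

(** A triangle inequality through the common point of the two rectangles, with [y1] along the first
    one and [y2] across it, so that it serves both orientations. *)
Lemma good_obstacle (R : realType) (mu lambda C T T' l m l' m' y1 y2 : R) :
  0 < lambda -> 0 < mu -> lambda + 2 * mu + 10 <= C -> 1 <= T -> T <= T' ->
  0 <= l <= T -> 0 <= m <= T -> `|y1 - l| <= 4 * T + 1 ->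
  `|y2 - m| <= (mu + 1) / 2 ->
  `|y1 - l'| <= (mu + 1) / 2 -> `|y2 - m'| <= (lambda * T' + 1) / 2 ->
  `|l'| <= C * T /\ `|m'| <= C * T'.
Proof.
move=> la0 mu0 hC T1 TT /andP[l0 lT] /andP[m0 mT].
rewrite !ler_distl !ler_norml => /andP[a1 a2] /andP[b1 b2] /andP[c1 c2] /andP[d1 d2].
have p1 : mu <= mu * T by rewrite ler_peMr// ltW.
have p2 : mu <= mu * T' by rewrite ler_peMr ?(ltW mu0)// (le_trans T1).
have p3 : 0 <= lambda * T by rewrite mulr_ge0 ?ltW// (lt_le_trans ltr01).
have p4 : 0 <= lambda * T' by rewrite mulr_ge0 ?ltW// (lt_le_trans ltr01)// (le_trans T1).
have q1 : (lambda + 2 * mu + 10) * T <= C * T by rewrite ler_wpM2r//; lra.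
have q2 : (lambda + 2 * mu + 10) * T' <= C * T' by rewrite ler_wpM2r//; lra.
by split; lra.
Qed.

Section good_geometry.
Context (R : realType) (lambda mu : R) (xi : nat -> nat -> int -> int -> bool).
Context (c s k : nat).
Hypothesis lambda10 : 10 <= lambda.
Hypothesis mu0 : 0 < mu.
Hypothesis hc : lambda + 2 * mu + 10 <= 2 ^+ c.
Hypothesis k0 : (0 < k)%N.

Lemma scale_le k' : (k <= k')%N -> scale R k <= scale R k'.
Proof. by move=> kk; rewrite ler_weXn2l// ler1n. Qed.

Lemma good_hor : good c s 1 k xi -> exists l m : nat,
  [/\ (l < 2 ^ (k - s))%N, (m < 2 ^ (k - s))%N &
   forall x : R * R, `|x.1 - l%:R| <= 4 * scale R k ->
     `|x.2 - m%:R| <= (mu - 1) / 2 -> weight lambda mu xi x <= - 2^-1].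
Proof.
move=> [[l [m [hl hm xlm]]] nohit]; exists l, m; split => // x h1 h2.
apply: weight_le => y e1; have T1 := scale_ge1 R k.
have [e2 e3] := euclid_ge (x - y).
(* The regularization looks at distance 1. The tube is thinner than the rectangle by exactly this
   margin, and [lambda >= 10] leaves more than enough room lengthwise. *)
have y1 : `|y.1 - l%:R| <= 4 * scale R k + 1.
  have -> : y.1 - l%:R = - (x - y).1 + (x.1 - l%:R) by rewrite /=; ring.
  by apply: le_trans (ler_normD _ _) _; rewrite normrN; lra.
have y2 : `|y.2 - m%:R| <= (mu + 1) / 2.
  have -> : y.2 - m%:R = - (x - y).2 + (x.2 - m%:R) by rewrite /=; ring.
  by apply: le_trans (ler_normD _ _) _; rewrite normrN; lra.
apply: (c2_hor (k := k)) => //.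
  exists l%:Z, m%:Z; split => //; split => //=.
  rewrite /= (le_trans y1)//.
  have : 10 * scale R k <= lambda * scale R k by rewrite ler_wpM2r//; lra.
  lra.
move=> k' kk [l' [m' [x' [v1 v2]]]]; apply/negP: x'.
have [a1 a2] := lt_scale R hl; have [b1 b2] := lt_scale R hm.
have [|||p1 p2] := @good_obstacle R mu lambda (2 ^+ c) _ _ l%:R m%:R l'%:~R m'%:~R
  y.1 y.2 _ mu0 hc T1 (scale_le kk) _ _ y1 y2 v1 v2.
- exact: lt_le_trans lambda10.
- by rewrite a1.
- by rewrite b1.
apply: (nohit k' l' m' kk); rewrite /hit eqxx.
by rewrite (absz_le_scale p1)// (absz_le_scale p2).
Qed.

Lemma good_ver : good c s 2 k xi -> exists l m : nat,
  [/\ (l < 2 ^ (k - s))%N, (m < 2 ^ (k - s))%N &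
   forall x : R * R, `|x.2 - m%:R| <= 4 * scale R k ->
     `|x.1 - l%:R| <= (mu - 1) / 2 -> 2^-1 <= weight lambda mu xi x].
Proof.
move=> [[l [m [hl hm xlm]]] nohit]; exists l, m; split => // x h1 h2.
apply: weight_ge => y e1; have T1 := scale_ge1 R k.
have [e2 e3] := euclid_ge (x - y).
have y2 : `|y.2 - m%:R| <= 4 * scale R k + 1.
  have -> : y.2 - m%:R = - (x - y).2 + (x.2 - m%:R) by rewrite /=; ring.
  by apply: le_trans (ler_normD _ _) _; rewrite normrN; lra.
have y1 : `|y.1 - l%:R| <= (mu + 1) / 2.
  have -> : y.1 - l%:R = - (x - y).1 + (x.1 - l%:R) by rewrite /=; ring.
  by apply: le_trans (ler_normD _ _) _; rewrite normrN; lra.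
apply: (c2_ver (k := k)) => //.
  exists l%:Z, m%:Z; split => //; split => //=.
  rewrite /= (le_trans y2)//.
  have : 10 * scale R k <= lambda * scale R k by rewrite ler_wpM2r//; lra.
  lra.
move=> k' kk [l' [m' [x' [v1 v2]]]]; apply/negP: x'.
have [a1 a2] := lt_scale R hl; have [b1 b2] := lt_scale R hm.
have [|||p1 p2] := @good_obstacle R mu lambda (2 ^+ c) _ _ m%:R l%:R m'%:~R l'%:~R
  y.2 y.1 _ mu0 hc T1 (scale_le kk) _ _ y2 y1 v2 v1.
- exact: lt_le_trans lambda10.
- by rewrite b1.
- by rewrite a1.
apply: (nohit k' l' m' kk); rewrite /hit /=.
by rewrite (absz_le_scale p1)// (absz_le_scale p2).
Qed.

End good_geometry.

(** * Good scales occur infinitely often *)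

Section independence.
Context (R : realType) (d : measure_display) (Omega : measurableType d)
  (P : probability Omega R) (X : nat -> nat -> int -> int -> {RV P >-> bool})
  (hX : bernoulli_field X).

Local Notation idx := (nat * nat * int * int)%type.

Definition used (i : idx) : bool := (1 <= i.1.1.1 <= 2)%N && (1 <= i.1.1.2)%N.

Definition bern_param (i : idx) : R := scale R i.1.1.2 ^- 2.

Definition all_zero (J : seq idx) : set Omega :=
  \bigcap_(i in [set` J]) X i.1.1.1 i.1.1.2 i.1.2 i.2 @^-1` [set false].

Definition zero_prob (J : seq idx) : R := \prod_(i <- J) (1 - bern_param i).

Lemma bern_param_bounds i : used i -> 0 < bern_param i <= 2^-1.
Proof.
move=> /andP[_ h]; rewrite /bern_param /scale -exprM.
rewrite invr_gt0 exprn_gt0//= lef_pV2 ?posrE ?exprn_gt0//.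
rewrite -[X in X <= _]expr1 ler_weXn2l ?ler1n//.
by rewrite muln2 -addnn (leq_trans h)// leq_addr.
Qed.

Lemma measurable_all_zero J : measurable (all_zero J).
Proof.
apply: fin_bigcap_measurable; first exact: finite_seq.
by move=> i _; apply: measurable_funPTI.
Qed.

Lemma all_zero_cat J K : all_zero (J ++ K) = all_zero J `&` all_zero K.
Proof.
rewrite -bigcap_setU; congr bigcap; apply/seteqP; split => i /=.
  by rewrite mem_cat => /orP.
by rewrite mem_cat => /orP.
Qed.

Lemma prob_all_zero J : uniq J -> all used J -> P (all_zero J) = (zero_prob J)%:E.
Proof.
move=> uJ /allP aJ; have [hi hb] := hX.
rewrite /all_zero (hi J (fun=> [set false]) uJ) => [||//]; last first.
  by move=> i /= /aJ /andP[].
rewrite /zero_prob -prodEFin; apply: eq_big_seq => i iJ.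
have /andP[h1 h2] := aJ _ iJ.
have /andP[p1 p2] := bern_param_bounds (aJ _ iJ).
have := hb i.1.1.1 i.1.1.2 i.1.2 i.2 h1 h2 [set false].
rewrite /distribution /pushforward => ->.
rewrite bernoulli_probE; last first.
  by rewrite (ltW p1) (le_trans p2)// invf_le1// ler1n.
have -> : \d_true [set false] = 0%E :> \bar R.
  by rewrite diracE memNset.
have -> : \d_false [set false] = 1%E :> \bar R.
  by rewrite diracE mem_set.
rewrite mule0 add0e mule1 /unstable.onem//.
Qed.

Lemma zero_prob_cat J K : zero_prob (J ++ K) = zero_prob J * zero_prob K.
Proof. by rewrite /zero_prob big_cat. Qed.

(** A block succeeds when one of its candidate centres, listed first, is present and all of its
    obstacles, listed second, are absent; here every block fails. *)
Fixpoint no_block (bs : seq (seq idx * seq idx)) : set Omega :=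
  if bs is b :: bs' then
    no_block bs' `&` ~` (~` all_zero b.1 `&` all_zero b.2)
  else setT.

Lemma measurable_no_block bs : measurable (no_block bs).
Proof.
elim: bs => [|b bs IH] /=; first exact: measurableT.
apply: measurableI => //; apply: measurableC; apply: measurableI.
  by apply: measurableC; exact: measurable_all_zero.
exact: measurable_all_zero.
Qed.

(* The complement of [~ Z1 /\ Z2] has indicator [1 - 1_Z2 + 1_(Z1 /\ Z2)], a combination
   of indicators of all-zero events: carrying one more such event [J] through the
   induction avoids any grouping lemma for independent families. *)
Lemma prob_no_block J bs :
  uniq (J ++ flatten [seq b.1 ++ b.2 | b <- bs]) ->
  all used (J ++ flatten [seq b.1 ++ b.2 | b <- bs]) ->
  P (all_zero J `&` no_block bs) =
  (zero_prob J * \prod_(b <- bs) (1 - zero_prob b.2 * (1 - zero_prob b.1)))%:E.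
Proof.
elim: bs J => [|b bs IH] J.
  by rewrite /= cats0 big_nil mulr1 setIT; exact: prob_all_zero.
rewrite /= => uJ aJ; rewrite big_cons.
set Z := flatten _ in uJ aJ IH.
have mz := measurable_all_zero.
have mn := measurable_no_block bs.
(* With [b.2] in front, [J], [J ++ b.2] and [J ++ b.2 ++ b.1] are nested prefixes, and the three
   uses of the induction hypothesis inherit distinctness from one list. *)
have p1 : perm_eq (J ++ (b.1 ++ b.2) ++ Z) ((J ++ b.2 ++ b.1) ++ Z).
  by rewrite -!catA perm_cat2l perm_catCA.
have u3 : uniq ((J ++ b.2 ++ b.1) ++ Z) by rewrite -(perm_uniq p1).
have a3 : all used ((J ++ b.2 ++ b.1) ++ Z) by rewrite -(perm_all _ p1).
have s1 : subseq (J ++ Z) ((J ++ b.2 ++ b.1) ++ Z).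
  by rewrite cat_subseq// prefix_subseq.
have s2 : subseq ((J ++ b.2) ++ Z) ((J ++ b.2 ++ b.1) ++ Z).
  by rewrite cat_subseq// catA prefix_subseq.
have aS K : subseq K ((J ++ b.2 ++ b.1) ++ Z) -> all used K.
  by move=> h; apply/allP => i /(mem_subseq h)/(allP a3).
have e1 := IH J (subseq_uniq s1 u3) (aS _ s1).
have e2 := IH (J ++ b.2) (subseq_uniq s2 u3) (aS _ s2).
have e3 := IH (J ++ b.2 ++ b.1) u3 a3.
move: e1 e2 e3; rewrite !all_zero_cat !zero_prob_cat.
set A := all_zero J; set B := all_zero b.2; set C := all_zero b.1.
set N := no_block bs; set pi := \prod_(_ <- _) _ => e1 e2 e3.
have mA : measurable A by exact: mz. have mB : measurable B by exact: mz.
have mC : measurable C by exact: mz.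
have -> : A `&` (N `&` ~` (~` C `&` B)) =
    (A `&` N) `\` ((A `&` B `&` N) `\` (A `&` (B `&` C) `&` N)).
  apply/seteqP; split => w /=; first by tauto.
  move=> [[aw nw] h]; split => //; split => // -[cw bw]; apply: h.
  by split => //; tauto.
have fin S : measurable S -> (P S < +oo)%E.
  by move=> mS; rewrite (le_lt_trans (probability_le1 P mS))// ltry.
rewrite measureD; [|by do ?apply: measurableI|
  by apply: measurableD; do ?apply: measurableI | by apply: fin; apply: measurableI].
have -> : A `&` N `&` ((A `&` B `&` N) `\` (A `&` (B `&` C) `&` N)) =
    (A `&` B `&` N) `\` (A `&` (B `&` C) `&` N).
  by apply/seteqP; split => w /=; tauto.
rewrite measureD; [|by do ?apply: measurableI|
  by do ?apply: measurableI | by apply: fin; do ?apply: measurableI].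
have -> : A `&` B `&` N `&` (A `&` (B `&` C) `&` N) = A `&` (B `&` C) `&` N.
  by apply/seteqP; split => w /=; tauto.
apply: (etrans (y := (_%:E - (_%:E - _%:E))%E)).
  by congr (_ - (_ - _))%E; [exact: e1 | exact: e2 | exact: e3].
rewrite -!EFinB; congr (_%:E); ring.
Qed.

Definition mean_ones (J : seq idx) : R := \sum_(i <- J) bern_param i.

Lemma mean_ones_ge0 J : 0 <= mean_ones J.
Proof. by apply: sumr_ge0 => i _; rewrite invr_ge0 !exprn_ge0. Qed.

Lemma zero_prob_le J : all used J -> zero_prob J <= expR (- mean_ones J).
Proof.
rewrite /zero_prob /mean_ones; elim: J => [|i J IH] /=.
  by rewrite !big_nil oppr0 expR0.
move=> /andP[/bern_param_bounds/andP[p0 p1] aJ].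
rewrite !big_cons opprD expRD ler_pM ?IH ?expR_ge1Dx//; first by lra.
rewrite big_seq; apply: prodr_ge0 => k /(allP aJ)/bern_param_bounds/andP[_]; lra.
Qed.

(** For [0 <= p <= 1/2], [exp (2 p) >= 1 + 2 p >= 1 / (1 - p)]. *)
Lemma zero_prob_ge J : all used J -> expR (- (2 * mean_ones J)) <= zero_prob J.
Proof.
rewrite /zero_prob /mean_ones; elim: J => [|i J IH] /=.
  by rewrite !big_nil mulr0 oppr0 expR0.
move=> /andP[/bern_param_bounds/andP[p0 p1] aJ].
rewrite !big_cons mulrDr opprD expRD ler_pM ?IH ?expR_ge0//.
rewrite expRN -[leRHS]invrK lef_pV2 ?posrE ?invr_gt0 ?expR_gt0//; last by lra.
apply: le_trans (expR_ge1Dx _).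
rewrite -div1r ler_pdivrMr; last by lra.
nra.
Qed.

Lemma zero_prob_ge1B J : all used J -> 1 - mean_ones J <= zero_prob J.
Proof.
rewrite /zero_prob /mean_ones; elim: J => [|i J IH] /=.
  by rewrite !big_nil subr0.
move=> /andP[/bern_param_bounds/andP[p0 p1] aJ].
rewrite !big_cons; have := IH aJ; have := mean_ones_ge0 J; rewrite /mean_ones.
move: (\sum_(_ <- _) _) (\prod_(_ <- _) _) => S Q S0 SQ; nra.
Qed.

Lemma prob_all_zeroC J : uniq J -> all used J ->
  (P (~` all_zero J) <= (mean_ones J)%:E)%E.
Proof.
move=> uJ aJ; rewrite probability_setC; last exact: measurable_all_zero.
rewrite prob_all_zero// -EFinB lee_fin.
by have := zero_prob_ge1B aJ; lra.
Qed.

Lemma mean_ones_const J k : {in J, forall i, i.1.1.2 = k} ->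
  mean_ones J = (size J)%:R * scale R k ^- 2.
Proof.
move=> h; rewrite /mean_ones (eq_big_seq (fun=> scale R k ^- 2)).
  by rewrite big_const_seq count_predT iter_addr_0 mulr_natl.
by move=> i /h hi; rewrite /bern_param hi.
Qed.

(** * Expected numbers of centres and of obstacles *)

Definition zrange (N : nat) : seq int :=
  [seq i%:Z - N%:Z | i <- iota 0 N.*2.+1].

Lemma mem_zrange (l : int) N : (l \in zrange N) = (`|l| <= N)%N.
Proof.
apply/mapP/idP => [[i]|h].
  by rewrite mem_iota add0n => /andP[_ hi] ->; lia.
by exists (absz (l + N%:Z)); [rewrite mem_iota add0n; lia | lia].
Qed.

Lemma zrange_uniq N : uniq (zrange N).
Proof. by rewrite map_inj_uniq ?iota_uniq// => i j; lia. Qed.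

Definition centers (s j k : nat) : seq idx :=
  [seq (j, k, l%:Z, m%:Z) | l <- iota 0 (2 ^ (k - s)), m <- iota 0 (2 ^ (k - s))].

Definition hits (c j k k' : nat) : seq idx :=
  if j == 1%N then
    [seq ((3 - j)%N, k', l, m) | l <- zrange (2 ^ (k + c)), m <- zrange (2 ^ (k' + c))]
  else
    [seq ((3 - j)%N, k', l, m) | l <- zrange (2 ^ (k' + c)), m <- zrange (2 ^ (k + c))].

Definition obstacles (c j k n : nat) : seq idx :=
  flatten [seq hits c j k (k + i)%N | i <- iota 0 n].

Lemma mem_centers s j k (i : idx) :
  i \in centers s j k -> i.1.1.1 = j /\ i.1.1.2 = k.
Proof. by rewrite /centers => /allpairsPdep[l [m [_ _ ->]]]. Qed.

Lemma mem_hits c j k k' (i : idx) :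
  i \in hits c j k k' <->
  [/\ i.1.1.1 = (3 - j)%N, i.1.1.2 = k' & hit c j k k' i.1.2 i.2].
Proof.
rewrite /hits /hit; case: ifP => _; split.
- by case/allpairsPdep => l [m []]; rewrite !mem_zrange => h1 h2 ->; rewrite h1 h2.
- move=> [e1 e2 /andP[h1 h2]]; apply/allpairsPdep; exists i.1.2, i.2.
  by split; rewrite ?mem_zrange// -e1 -e2; case: (i) => [[[]]].
- by case/allpairsPdep => l [m []]; rewrite !mem_zrange => h1 h2 ->; rewrite h1 h2.
- move=> [e1 e2 /andP[h1 h2]]; apply/allpairsPdep; exists i.1.2, i.2.
  by split; rewrite ?mem_zrange// -e1 -e2; case: (i) => [[[]]].
Qed.

Lemma mem_obstacles c j k n (i : idx) : i \in obstacles c j k n ->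
  [/\ i.1.1.1 = (3 - j)%N, (k <= i.1.1.2)%N & (i.1.1.2 < k + n)%N].
Proof.
case/flatten_mapP => a; rewrite mem_iota add0n => /andP[_ an].
by move=> /mem_hits[-> -> _]; rewrite leq_addr ltn_add2l.
Qed.

Lemma centers_uniq s j k : uniq (centers s j k).
Proof.
by apply: allpairs_uniq; rewrite ?iota_uniq// => -[a b] [a' b'] _ _ /= [-> ->].
Qed.

Lemma hits_uniq c j k k' : uniq (hits c j k k').
Proof.
rewrite /hits; case: ifP => _;
by apply: allpairs_uniq; rewrite ?zrange_uniq// => -[a b] [a' b'] _ _ /= [-> ->].
Qed.

Lemma obstacles_uniq c j k n : uniq (obstacles c j k n).
Proof.
rewrite /obstacles; elim: n => // n IH.
rewrite -addn1 iotaD map_cat flatten_cat cat_uniq IH /= cats0 hits_uniq andbT.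
apply/hasPn => i /mem_hits[_ h _]; apply/negP => /mem_obstacles[_ _].
by rewrite h add0n ltnn.
Qed.

(** There are [4 ^ (k - s)] candidates of probability [4 ^- k] each: the expected number does not
    depend on the level, which makes all scales equally likely to be good. *)
Lemma mean_ones_centers s j k : (s <= k)%N ->
  mean_ones (centers s j k) = 4 ^- s.
Proof.
move=> sk; rewrite (@mean_ones_const _ k) => [|i /mem_centers[]//].
rewrite size_allpairs !size_iota natrM !natrX /scale -exprM mulnC exprM.
rewrite -expr2 -exprM mulnC exprM (_ : 2 ^+ 2 = 4 :> R); last by ring.
rewrite -[in X in _ / X](subnK sk) exprD invfM mulrA divff ?mul1r//.
Qed.

(** The region is of order [2 ^ k] in one direction and [2 ^ (k + i)] in the other, against a
    density [4 ^- (k + i)]: the gain [2 ^- i] makes obstacles summable over levels. *)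
Lemma mean_ones_hits c j k i :
  mean_ones (hits c j k (k + i)) <= 9 * 4 ^+ c * 2 ^- i.
Proof.
rewrite (@mean_ones_const _ (k + i)) => [|a /mem_hits[]//].
have hz N : (size (zrange (2 ^ N)))%:R <= 3 * 2 ^+ N :> R.
  rewrite size_map size_iota -addn1 -mul2n natrD natrM natrX.
  by have : 1 <= 2 ^+ N :> R by [rewrite exprn_ege1// ler1n]; lra.
have -> : size (hits c j k (k + i)) =
    (size (zrange (2 ^ (k + c))) * size (zrange (2 ^ (k + i + c))))%N.
  by rewrite /hits; case: ifP => _; rewrite size_allpairs// mulnC.
rewrite ler_pdivrMr ?exprn_gt0// natrM.
apply: le_trans (ler_pM _ _ (hz _) (hz _)) _ => //.
rewrite le_eqVlt; apply/orP; left; apply/eqP.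
rewrite /scale !exprD (_ : 4 = 2 * 2 :> R); last by ring.
by rewrite exprMn; field; rewrite expf_neq0.
Qed.

Lemma sum_half n : \sum_(i <- iota 0 n) 2 ^- i <= 2 :> R.
Proof.
suff -> : \sum_(i <- iota 0 n) 2 ^- i = 2 - 2 * 2 ^- n :> R.
  by rewrite gerBl mulr_ge0// invr_ge0 exprn_ge0.
elim: n => [|n IH]; first by rewrite big_nil expr0 invr1; ring.
rewrite -addn1 iotaD big_cat IH /= big_seq1 add0n addn1 exprS; field.
by rewrite expf_neq0.
Qed.

Lemma mean_ones_obstacles c j k n :
  mean_ones (obstacles c j k n) <= 18 * 4 ^+ c.
Proof.
rewrite /mean_ones /obstacles big_flatten /= big_map.
apply: (@le_trans _ _ (\sum_(i <- iota 0 n) 9 * 4 ^+ c * 2 ^- i)).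
  by apply: ler_sum => i _; exact: mean_ones_hits.
rewrite -mulr_sumr; have := sum_half n; have : 0 <= 4 ^+ c :> R by [].
nra.
Qed.

Arguments centers : simpl never.
Arguments obstacles : simpl never.
Arguments hits : simpl never.

(* A block started at level [k] uses the levels [k, ..., 2k] only, so that successive
   blocks are disjoint. *)
Fixpoint blocks (c s j N k : nat) : seq (seq idx * seq idx) :=
  if N is N'.+1 then
    (centers s j k, obstacles c j k k.+1) :: blocks c s j N' k.*2.+1
  else [::].

(** An obstacle appears at one of the levels above [2k], which the block started at [k] ignores. *)
Definition tail (c j k : nat) : set Omega :=
  \bigcup_n ~` all_zero (hits c j k (k + (k.+1 + n))).

Fixpoint tails (c j N k : nat) : set Omega :=
  if N is N'.+1 then tail c j k `|` tails c j N' k.*2.+1 else set0.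

Lemma all_used_centers s j k : (1 <= j <= 2)%N -> (0 < k)%N ->
  all used (centers s j k).
Proof.
by move=> j12 k0; apply/allP => i /mem_centers[h1 h2]; rewrite /used h1 h2 j12 k0.
Qed.

Lemma all_used_hits c j k k' : (1 <= j <= 2)%N -> (0 < k')%N ->
  all used (hits c j k k').
Proof.
move=> j12 k0; apply/allP => i /mem_hits[h1 h2 _]; rewrite /used h1 h2 k0.
lia.
Qed.

Lemma all_used_obstacles c j k n : (1 <= j <= 2)%N -> (0 < k)%N ->
  all used (obstacles c j k n).
Proof.
move=> j12 k0; apply/allP => i /mem_obstacles[h1 h2 _].
rewrite /used h1 (leq_trans k0 h2); lia.
Qed.

Lemma blocks_level c s j N k (i : idx) :
  i \in flatten [seq b.1 ++ b.2 | b <- blocks c s j N k] -> (k <= i.1.1.2)%N.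
Proof.
elim: N k => [//|N IH] k.
rewrite /= mem_cat (mem_cat i (centers s j k)) => /orP[/orP[]|].
- by move/mem_centers => [_ ->].
- by case/mem_obstacles.
- by move/IH; lia.
Qed.

(** Within a block the two lists come from the distinct families [j] and [3 - j]; different blocks
    use disjoint ranges of levels. *)
Lemma blocks_uniq c s j N k : (1 <= j <= 2)%N ->
  uniq (flatten [seq b.1 ++ b.2 | b <- blocks c s j N k]).
Proof.
move=> j12; elim: N k => [//|N IH] k.
rewrite /= cat_uniq (cat_uniq (centers s j k)) IH andbT.
rewrite centers_uniq obstacles_uniq andbT /=.
apply/andP; split.
  apply/hasPn => i /mem_obstacles[h _ _]; apply/negP => /mem_centers[h' _].
  by move: j12; rewrite -h' h; lia.
apply/hasPn => i /blocks_level h; apply/negP; rewrite mem_cat => /orP[].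
  by move/mem_centers => [_ h']; lia.
by case/mem_obstacles; lia.
Qed.

Lemma blocks_used c s j N k : (1 <= j <= 2)%N -> (0 < k)%N ->
  all used (flatten [seq b.1 ++ b.2 | b <- blocks c s j N k]).
Proof.
move=> j12; elim: N k => [//|N IH] k k0.
rewrite /= all_cat (all_cat _ (centers s j k)) IH//.
by rewrite all_used_centers// all_used_obstacles.
Qed.

(** The failure probability of a block is bounded away from 1 uniformly in its level; 36 is twice
    the bound 18 on the obstacles, through [zero_prob_ge]. *)
Lemma prob_blocks c s j N k : (1 <= j <= 2)%N -> (s < k)%N ->
  (P (no_block (blocks c s j N k)) <=
   ((1 - expR (- (36 * 4 ^+ c)) * (1 - expR (- 4 ^- s))) ^+ N)%:E)%E.
Proof.
move=> j12 sk; have k0 : (0 < k)%N by apply: leq_ltn_trans sk.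
have E : no_block (blocks c s j N k) =
    all_zero [::] `&` no_block (blocks c s j N k).
  by rewrite /all_zero set_nil bigcap_set0 setTI.
rewrite E prob_no_block ?blocks_uniq ?blocks_used//.
rewrite /zero_prob big_nil mul1r lee_fin.
have e0 : 0 <= 1 - expR (- 4 ^- s) :> R.
  by rewrite subr_ge0 expR_le1 oppr_le0 invr_ge0.
have e1 : expR (- (36 * 4 ^+ c)) <= 1 :> R.
  by rewrite expR_le1 oppr_le0 mulr_ge0.
(* Nonnegativity is carried along so that the inequalities can be multiplied in the induction. *)
suff /andP[] : 0 <= \prod_(b <- blocks c s j N k)
     (1 - \prod_(i <- b.2) (1 - bern_param i) *
       (1 - \prod_(i <- b.1) (1 - bern_param i))) <=
  (1 - expR (- (36 * 4 ^+ c)) * (1 - expR (- 4 ^- s))) ^+ N by [].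
elim: N k sk k0 {E} => [|N IH] k sk k0.
  by rewrite /= big_nil expr0 ler01 lexx.
have sk' : (s < k.*2.+1)%N by rewrite ltnS -addnn (leq_trans (ltnW sk))// leq_addr.
have k0' : (0 < k.*2.+1)%N by [].
rewrite /= big_cons exprS -/(zero_prob _) -/(zero_prob _) /=.
have uc := all_used_centers s j12 k0.
have uo := all_used_obstacles c k.+1 j12 k0.
have h1 := zero_prob_le uc; rewrite mean_ones_centers ?(ltnW sk)// in h1.
have h2 := zero_prob_ge uo.
have h3 : expR (- (36 * 4 ^+ c)) <= zero_prob (obstacles c j k k.+1).
  apply: le_trans h2; rewrite ler_expR lerN2.
  by have := mean_ones_obstacles c j k k.+1; lra.
have h4 : zero_prob (obstacles c j k k.+1) <= 1.
  apply: le_trans (zero_prob_le uo) _.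
  by rewrite expR_le1 oppr_le0 mean_ones_ge0.
have h5 : 0 <= zero_prob (centers s j k).
  exact: le_trans (expR_ge0 _) (zero_prob_ge uc).
have h6 : 0 <= expR (- (36 * 4 ^+ c)) :> R by exact: expR_ge0.
have h7 : expR (- (36 * 4 ^+ c)) * (1 - expR (- 4 ^- s)) <=
    zero_prob (obstacles c j k k.+1) * (1 - zero_prob (centers s j k)).
  by apply: ler_pM => //; rewrite lerD2l lerN2.
have h8 : 0 <= 1 - zero_prob (obstacles c j k k.+1) * (1 - zero_prob (centers s j k)).
  rewrite subr_ge0 mulr_ile1//; [exact: le_trans h6 h3| |lra].
  by rewrite subr_ge0 (le_trans h1)// expR_le1 oppr_le0 invr_ge0.
have /andP[i1 i2] := IH _ sk' k0'.
by rewrite mulr_ge0//= ler_pM// lerD2l lerN2.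
Qed.

Lemma measurable_tail c j k : measurable (tail c j k).
Proof.
by apply: bigcup_measurable => n _; apply: measurableC; exact: measurable_all_zero.
Qed.

Lemma prob_tail c j k : (1 <= j <= 2)%N ->
  (P (tail c j k) <= (9 * 4 ^+ c * 2 ^- k)%:E)%E.
Proof.
move=> j12.
have C0 : 0 <= 9 * 4 ^+ c :> R by rewrite mulr_ge0.
apply: le_trans (measure_sigma_subadditive P _ (measurable_tail c j k) _) _;
  [|exact: subset_refl|].
  by move=> n; apply: measurableC; exact: measurable_all_zero.
have h n : (P (~` all_zero (hits c j k (k + (k.+1 + n)))) <=
    (9 * 4 ^+ c * 2 ^- (k.+1 + n))%:E)%E.
  apply: (le_trans (prob_all_zeroC (hits_uniq _ _ _ _) _)).
    by apply: all_used_hits => //; rewrite addnS.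
  by rewrite lee_fin mean_ones_hits.
apply: lime_le; first by apply: is_cvg_nneseries => n _ _; exact: measure_ge0.
apply: nearW => n /=.
apply: le_trans (lee_sum _ (fun i _ => h i)) _.
rewrite sumEFin lee_fin.
rewrite (eq_bigr (fun i => 9 * 4 ^+ c * 2 ^- k.+1 * 2 ^- i)); last first.
  by move=> i _; rewrite exprD invfM mulrA.
rewrite -mulr_sumr /index_iota subn0.
have := sum_half n; have : 0 < 2 ^- k :> R by rewrite invr_gt0 exprn_gt0.
rewrite exprS invfM; move: (\sum_(_ <- _) _) (2 ^- k) => S e e0 S2.
have -> : 9 * 4 ^+ c * (2^-1 * e) * S = 9 * 4 ^+ c * e * (S / 2) by ring.
rewrite -[leRHS]mulr1 ler_wpM2l ?mulr_ge0 ?(ltW e0)//; lra.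
Qed.

Lemma measurable_tails c j N k : measurable (tails c j N k).
Proof.
elim: N k => [|N IH] k; first exact: measurable0.
by apply: measurableU; [exact: measurable_tail | exact: IH].
Qed.

Lemma prob_tails c j N k : (1 <= j <= 2)%N ->
  (P (tails c j N k) <= (N%:R * (9 * 4 ^+ c * 2 ^- k))%:E)%E.
Proof.
move=> j12; elim: N k => [|N IH] k; first by rewrite /= measure0 mul0r.
apply: le_trans (measureU2 _ (measurable_tail _ _ _) (measurable_tails _ _ _ _)) _.
rewrite -natr1 addrC mulrDl mul1r EFinD leeD ?prob_tail//.
apply: le_trans (IH _) _; rewrite lee_fin ler_wpM2l// ler_wpM2l ?mulr_ge0//.
rewrite lef_pV2 ?posrE ?exprn_gt0// ler_weXn2l ?ler1n//.
by rewrite -addnn -addnS leq_addr.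
Qed.

(** A block that succeeds and has no obstacle in its tail makes its starting level good. *)
Lemma never_good_sub c s j n N k : (n <= k)%N ->
  [set w | forall k', (n <= k')%N ->
     ~ good c s j k' (fun j k l m => X j k l m w)] `<=`
  no_block (blocks c s j N k) `|` tails c j N k.
Proof.
move=> nk w bad; elim: N k nk => [|N IH] k nk; first by left.
have nk' : (n <= k.*2.+1)%N.
  by rewrite (leq_trans nk)// -addnn -addnS leq_addr.
have [h|h] := IH _ nk'; last by right; right.
have [ht|ht] := pselect (tail c j k w); first by right; left.
left; split => // -[hc ho]; apply: (bad k nk); split.
  move/existsNP : hc => [i /not_implyP[iJ hX0]].
  move: iJ => /allpairsPdep[l [m []]].
  rewrite !mem_iota !add0n => lk mk iE.
  exists l, m; split => //; move: hX0; rewrite iE /=.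
  by case: (X _ _ _ _ _).
move=> k' l m kk hh; apply/negP => hx.
have iE : ((3 - j)%N, k', l, m) \in hits c j k k' by apply/mem_hits.
have [kk'|kk'] := leqP k' (k + k).
  have : ((3 - j)%N, k', l, m) \in obstacles c j k k.+1.
    apply/flatten_mapP; exists (k' - k)%N; last by rewrite subnKC.
    by rewrite mem_iota add0n ltnS leq_subLR.
  by move/ho => /=; rewrite hx.
apply: ht; exists (k' - (k + k.+1))%N => //.
rewrite addnA subnKC; last by rewrite addnS.
by move/(_ _ iE) => /=; rewrite hx.
Qed.

Lemma never_good_negligible c s j n : (1 <= j <= 2)%N ->
  P.-negligible [set w | forall k', (n <= k')%N ->
     ~ good c s j k' (fun j k l m => X j k l m w)].
Proof.
move=> j12.
set th : R := 1 - expR (- (36 * 4 ^+ c)) * (1 - expR (- 4 ^- s)).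
have th1 : `|th| < 1.
  have a1 : 0 < expR (- (36 * 4 ^+ c)) :> R by exact: expR_gt0.
  have a2 : expR (- (36 * 4 ^+ c)) <= 1 :> R.
    by rewrite expR_le1 oppr_le0 mulr_ge0.
  have b1 : 0 < expR (- 4 ^- s) :> R by exact: expR_gt0.
  have b2 : expR (- 4 ^- s) < 1 :> R.
    by rewrite expR_lt1 oppr_lt0 invr_gt0 exprn_gt0.
  rewrite /th; move: a1 a2 b1 b2; move: (expR _) (expR _) => a b a1 a2 b1 b2.
  rewrite ltr_norml; apply/andP; split; nra.
have small (e : R) : 0 < e -> exists E, [/\ measurable E, (P E <= e%:E)%E &
    [set w | forall k', (n <= k')%N ->
     ~ good c s j k' (fun j k l m => X j k l m w)] `<=` E].
  move=> e0; have e2 : 0 < e / 2 by rewrite divr_gt0.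
  have /cvgrPdist_lt/(_ _ e2)[N _ /(_ N (leqnn N))] := cvg_expr th1.
  rewrite /= sub0r normrN => hN.
  (* The number [N] of blocks is fixed first, so that all fail with probability below [e / 2]; then
     the starting level is pushed up until the [N] tails together weigh at most [e / 2]. *)
  pose C := N%:R * (9 * 4 ^+ c) / (e / 2) : R.
  pose k := (Num.truncn C + n + s).+1.
  have sk : (s < k)%N by rewrite /k ltnS leq_addl.
  have nk : (n <= k)%N by rewrite /k leqW// -addnA addnCA leq_addr.
  exists (no_block (blocks c s j N k) `|` tails c j N k); split.
  - by apply: measurableU; [exact: measurable_no_block|exact: measurable_tails].
  - apply: le_trans (measureU2 _ (measurable_no_block _) (measurable_tails _ _ _ _)) _.
    apply: le_trans (leeD (prob_blocks _ _ j12 sk) (prob_tails _ _ _ j12)) _.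
    rewrite -EFinD lee_fin -/th.
    have := ler_norm (th ^+ N).
    suff : N%:R * (9 * 4 ^+ c * 2 ^- k) <= e / 2 by lra.
    rewrite mulrA ler_pdivrMr ?exprn_gt0// [leRHS]mulrC -ler_pdivrMr// -/C.
    apply: ltW; apply: lt_le_trans (truncnS_gt C) _.
    rewrite -natrX ler_nat ltnW// (leq_ltn_trans _ (ltn_expl _ _))//.
    by rewrite /k ltnS -addnA leq_addr.
  - exact: never_good_sub.
have pos m : 0 < m.+1%:R^-1 :> R by rewrite invr_gt0.
have [F hF] := choice (fun m => small _ (pos m)).
exists (\bigcap_m F m); split.
- by apply: bigcap_measurableType => m _; case: (hF m).
- apply/eqP; rewrite eq_le measure_ge0 andbT.
  apply/lee_addgt0Pr => e e0; rewrite add0e.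
  pose m := Num.truncn e^-1; have [mF PF _] := hF m.
  apply: le_trans (le_measure _ _ _ (bigcap_inf (i := m) I)) _ => //.
  + by rewrite inE; apply: bigcap_measurableType => i _; case: (hF i).
  + by rewrite inE.
  apply: le_trans PF _; rewrite lee_fin -[leRHS]invrK lef_pV2 ?posrE ?invr_gt0//.
  exact/ltW/truncnS_gt.
- by move=> w hw m _; have [_ _] := hF m; apply.
Qed.

End independence.

(** * Oscillation of the solution *)

Lemma rescaled_cube (R : realType) (eta : R) (s k l : nat) :
  (s < k)%N -> 2 ^- s <= eta / 32 -> (l < 2 ^ (k - s))%N ->
  0 <= 2 ^- k * l%:R :> R /\ 2 ^- k * l%:R <= eta / 32.
Proof.
move=> sk hs hl; split; first by rewrite mulr_ge0 ?invr_ge0.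
apply: le_trans hs.
rewrite -(subnK (ltnW sk)) exprD invfM mulrAC -[leRHS]mul1r ler_wpM2r ?invr_ge0//.
by rewrite mulrC ler_pdivrMr ?exprn_gt0// mul1r -natrX ler_nat ltnW.
Qed.

Section good_scale.
Context (R : realType) (eta lambda mu q : R) (c s k : nat).
Context (xi : nat -> nat -> int -> int -> bool) (u : R * (R * R) -> R).
Hypothesis heta : 0 < eta < 2^-1.
Hypothesis hmin : 16 / eta <= Num.min lambda mu.
Hypothesis hq : 1 < q.
Hypothesis hc : lambda + 2 * mu + 10 <= 2 ^+ c.
Hypothesis hs : 2 ^- s <= eta / 32.
Hypothesis sk : (s < k)%N.
Hypothesis hk : 2 ^- k <= eta ^+ 2 / 1024.
Hypothesis hu : viscosity_solution (2 ^- k)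
  (fun p x => hamiltonian q (weight lambda mu xi) p
     (x.1 / 2 ^- k, x.2 / 2 ^- k)) u.

Let eps : R := 2 ^- k.

Let lambda_mu : [/\ 10 <= lambda, 0 < mu & 7 / eta <= (mu - 1) / 2].
Proof.
move: heta hmin => /andP[e0 e1]; rewrite le_min => /andP[h1 h2].
(* Hence [(mu - 1) / 2 >= 8 / eta - 1 / 2 >= 7 / eta], the half-width wanted by the barrier. *)
have e2 : 2 <= eta^-1 by rewrite -[leLHS]invrK lef_pV2 ?posrE// ltW.
by split; lra.
Qed.

Let eps_gt0 : 0 < eps. Proof. by rewrite invr_gt0 exprn_gt0. Qed.

Let near_center (x b : R) (l : nat) : `|x - eps * l%:R| <= eps * b ->
  `|x / eps - l%:R| <= b.
Proof.
move=> h; have -> : x / eps - l%:R = eps^-1 * (x - eps * l%:R).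
  by field; rewrite gt_eqF.
by rewrite normrM gtr0_norm ?invr_gt0// ler_pdivrMl.
Qed.

Lemma good_solution_le : good c s 1 k xi -> u (1, (0, 0)) <= - 2^-1 + eta.
Proof.
have [l10 mu0 m7] := lambda_mu.
move=> /(good_hor l10 mu0 hc (leq_ltn_trans (leq0n s) sk))[l [m [hl hm hw]]].
have h4 : 4 = eps * (4 * scale R k).
  by rewrite /eps /scale; field; rewrite expf_neq0.
apply: (@solution_le _ eta (eps * l%:R) (eps * m%:R) eps q
  (weight lambda mu xi)) => //; first by rewrite eps_gt0.
- by apply/andP; exact: rescaled_cube hs hl.
- by apply/andP; exact: rescaled_cube hs hm.
- by move=> x; have /andP[] := weight_bounded lambda mu xi x.
move=> x h1 h2; apply: hw => /=.
  by apply: near_center; rewrite -h4.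
apply: near_center; apply: le_trans h2 _.
by rewrite ler_pM2l.
Qed.

Lemma good_solution_ge : good c s 2 k xi -> 2^-1 - eta <= u (1, (0, 0)).
Proof.
have [l10 mu0 m7] := lambda_mu.
move=> /(good_ver l10 mu0 hc (leq_ltn_trans (leq0n s) sk))[l [m [hl hm hw]]].
have h4 : 4 = eps * (4 * scale R k).
  by rewrite /eps /scale; field; rewrite expf_neq0.
apply: (@solution_ge _ eta (eps * m%:R) (eps * l%:R) eps q
  (weight lambda mu xi)) => //; first by rewrite eps_gt0.
- by apply/andP; exact: rescaled_cube hs hm.
- by apply/andP; exact: rescaled_cube hs hl.
- by move=> x; have /andP[] := weight_bounded lambda mu xi x.
move=> x h1 h2; apply: hw => /=.
  by apply: near_center; rewrite -h4.
apply: near_center; apply: le_trans h2 _.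
by rewrite ler_pM2l.
Qed.

End good_scale.

(** * From dyadic scales to lower and upper limits *)

Lemma pow_half_le (R : realType) (e : R) : 0 < e ->
  exists n, forall k, (n <= k)%N -> 2 ^- k < e.
Proof.
move=> e0; exists (Num.truncn e^-1).+1 => k hk.
rewrite -[ltRHS]invrK ltf_pV2 ?posrE ?invr_gt0 ?exprn_gt0//.
apply: lt_le_trans (truncnS_gt _) _.
by rewrite -natrX ler_nat (leq_trans hk)// ltnW// ltn_expl.
Qed.

Lemma at_right_pow_half (R : realType) (V : set R) : 0^'+ V ->
  exists n, forall k, (n <= k)%N -> V (2 ^- k).
Proof.
case=> e /= e0 h; have [n hn] := pow_half_le e0.
exists n => k nk; have p0 : 0 < 2 ^- k :> R by rewrite invr_gt0 exprn_gt0.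
by apply: h => //=; rewrite sub0r normrN gtr0_norm// hn.
Qed.

Lemma limf_einf_le_frequent (R : realType) (f : R -> R) (b : R) :
  (forall n, exists k, (n <= k)%N /\ f (2 ^- k) <= b) ->
  (limf_einf (EFin \o f) 0^'+ <= b%:E)%E.
Proof.
move=> hf; rewrite limf_einfE; apply: ge_ereal_sup => _ [V hV <-].
have [n hn] := at_right_pow_half hV; have [k [nk fk]] := hf n.
apply: (@le_trans _ _ (f (2 ^- k))%:E); last by rewrite lee_fin.
by apply: ereal_inf_lbound; exists (2 ^- k) => //; exact: hn.
Qed.

Lemma limf_esup_ge_frequent (R : realType) (f : R -> R) (b : R) :
  (forall n, exists k, (n <= k)%N /\ b <= f (2 ^- k)) ->
  (b%:E <= limf_esup (EFin \o f) 0^'+)%E.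
Proof.
move=> hf; rewrite limf_esupE; apply: le_ereal_inf_tmp => _ [V hV <-].
have [n hn] := at_right_pow_half hV; have [k [nk fk]] := hf n.
apply: (@le_trans _ _ (f (2 ^- k))%:E); first by rewrite lee_fin.
by apply: ereal_sup_ubound; exists (2 ^- k) => //; exact: hn.
Qed.

Lemma not_cvg_frequent (R : realType) (f : R -> R) (l a b : R) : a < b ->
  (forall n, exists k, (n <= k)%N /\ f (2 ^- k) <= a) ->
  (forall n, exists k, (n <= k)%N /\ b <= f (2 ^- k)) ->
  ~ (forall e, 0 < e -> \forall x \near 0^'+, `|l - f x| < e).
Proof.
move=> ab ha hb hl; have e0 : 0 < (b - a) / 2 by rewrite divr_gt0 ?subr_gt0.
have [n hn] := at_right_pow_half (hl _ e0).
have [k [nk fk]] := ha n; have [k' [nk' fk']] := hb n.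
move: (hn _ nk) (hn _ nk') => /=; rewrite !ltr_norml => /andP[? ?] /andP[? ?].
lra.
Qed.

Unset Implicit Arguments.
Set Strict Implicit.

Theorem theorem2 (R : realType) (d : measure_display) (Omega : measurableType d)
    (P : probability Omega R)
    (X : nat -> nat -> int -> int -> {RV P >-> bool})
    (hX : bernoulli_field X)
    (eta lambda mu q : R)
    (heta : 0 < eta < 2^-1)
    (hlambda : 0 < lambda) (hmu : 0 < mu)
    (hmin : 16 / eta <= Num.min lambda mu)
    (hq : 1 < q)
    (u : R -> Omega -> R * (R * R) -> R)
    (hu : {ae P, forall omega, forall eps : R, 0 < eps ->
       viscosity_solution eps
         (fun p x => hamiltonian q
            (weight lambda mu (fun j k l m => X j k l m omega))
            p (x.1 / eps, x.2 / eps))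
         (u eps omega)}) :
  {ae P, forall omega,
     (limf_einf (fun eps => (u eps omega (1, (0, 0)))%:E) 0^'+
        <= (- 2^-1 + eta)%:E)%E /\
     ((2^-1 - eta)%:E
        <= limf_esup (fun eps => (u eps omega (1, (0, 0)))%:E) 0^'+)%E} /\
  ~ (exists (Hbar : R * R -> R) (ubar : R * (R * R) -> R),
       [/\ continuous Hbar,
           viscosity_solution 0 (fun p _ => Hbar p) ubar &
           {ae P, forall omega,
              locally_uniform_cvg (fun eps => u eps omega) ubar}]).
Proof.
have /andP[eta0 eta1] := heta.
have [c hc] : exists c, lambda + 2 * mu + 10 <= 2 ^+ c.
  exists (Num.truncn (lambda + 2 * mu + 10)).+1.
  apply: ltW; apply: lt_le_trans (truncnS_gt _) _.
  by rewrite -natrX ler_nat ltnW// ltn_expl.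
have [s hs] : exists s, 2 ^- s <= eta / 32.
  have [|n hn] := @pow_half_le R (eta / 32); first by rewrite divr_gt0.
  by exists n; apply/ltW/hn.
have [k0 hk0] : exists k0, forall k, (k0 <= k)%N -> 2 ^- k < eta ^+ 2 / 1024.
  have e2 := exprn_gt0 2 eta0.
  have e3 : 0 < eta ^+ 2 / 1024 by lra.
  exact: pow_half_le e3.
have large n k : (n + s.+1 + k0 <= k)%N -> [/\ (n <= k)%N, (s < k)%N & (k0 <= k)%N].
  move=> h; split; apply: leq_trans h.
  - by rewrite -addnA leq_addr.
  - by rewrite addnAC leq_addl.
  - exact: leq_addl.
have frequently_good j : (1 <= j <= 2)%N -> {ae P, forall w, forall n, exists k,
    (n <= k)%N /\ good c s j k (fun j k l m => X j k l m w)}.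
  move=> j12; have := negligible_bigcup (fun n =>
    never_good_negligible hX c s n j12).
  apply: negligibleS => w /existsNP[n hn]; exists n => // k nk hg.
  by apply: hn; exists k.
(* Family 1 supplies infinitely many scales with the upper bound, family 2 infinitely many with the
   lower one, on a common event of full measure. *)
have osc : {ae P, forall w,
    (forall n, exists k, (n <= k)%N /\ u (2 ^- k) w (1, (0, 0)) <= - 2^-1 + eta) /\
    (forall n, exists k, (n <= k)%N /\ 2^-1 - eta <= u (2 ^- k) w (1, (0, 0)))}.
  have := frequently_good 1%N isT; have := frequently_good 2%N isT.
  move: hu; apply: filterS3 => w uw g2 g1.
  have p0 k : 0 < 2 ^- k :> R by rewrite invr_gt0 exprn_gt0.
  have uk k := uw _ (p0 k).
  split => n.
    have [k [/large[nk sk kk] gk]] := g1 (n + s.+1 + k0)%N; exists k; split => //.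
    exact: good_solution_le heta hmin hq hc hs sk (ltW (hk0 _ kk)) (uk k) gk.
  have [k [/large[nk sk kk] gk]] := g2 (n + s.+1 + k0)%N; exists k; split => //.
  exact: good_solution_ge heta hmin hq hc hs sk (ltW (hk0 _ kk)) (uk k) gk.
split.
  move: osc; apply: filterS => w [h1 h2]; split.
    exact: limf_einf_le_frequent h1.
  exact: limf_esup_ge_frequent h2.
move=> [Hbar [ubar [_ _ hcvg]]].
have P1 : (P [set: Omega] > 0)%E by rewrite probability_setT lte01.
(* The almost sure filter is proper, so some realization both oscillates and converges. *)
have PF := ae_properfilter_algebraOfSetsType P1.
have [w [[h1 h2] h3]] := filter_ex (filterI osc hcvg).
have ab : - 2^-1 + eta < 2^-1 - eta by lra.
apply: (@not_cvg_frequent R (fun eps => u eps w (1, (0, 0)))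
  (ubar (1, (0, 0))) _ _ ab h1 h2) => e e0.
(* Uniform convergence on this single point already contradicts the gap between [- 1/2 + eta] and
   [1/2 - eta]. *)
have cK : compact [set ((1, (0, 0)) : R * (R * R))] by exact: compact_set1.
have := h3 _ cK; rewrite uniform_set1 => h.
have {h}/cvgrPdist_lt : u eps w (1, (0, 0)) @[eps --> 0^'+] --> ubar (1, (0, 0)).
  by apply: h => z ->; exact: ler01.
exact.
Qed.
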